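(* Let $\phi$ be convex and $C:[0,1]\to\mathbb{R}_{\ge0}$. If $\mu$ is $\phi$-entropically stable with rate $C$ with respect to a noising process $(X_t)_{t\in[0,1]}$ with $X_0\sim\mu$, then for every $\theta\in[0,1]$ and all $f:\mathcal{X}\to\mathbb{R}_{\ge0}$, $$\mathrm{Ent}^\phi_\mu[f]\le\exp\left(\int_0^\theta\frac{C(\eta)}{1-\eta}\,\mathrm{d}\eta\right)\mathbb{E}_{x\sim\mu_\theta}\left[\mathrm{Ent}^\phi_{Q_{\theta\to1}(x,\cdot)}[f]\right],$$ i.e., the process satisfies $K$-approximate conservation of $\phi$-entropy from time $\theta$ with $K=\exp\left(\int_0^\theta\frac{C(\eta)}{1-\eta}\,\mathrm{d}\eta\right)$.
   Context: Let $\mu$ be a distribution on a finite set $\mathcal{X}\subseteq\mathbb{R}^n$. A noising process is a (generally time-inhomogeneous) Markov process $(X_t)_{t\in[0,1]}$ with $X_0\sim\mu$ and $X_1=\mathbf 0$ almost surely; its time reversal $(Y_\theta)_{\theta\in[0,1]}$ ($Y_\theta\overset{d}{=}X_{1-\theta}$ as processes) is the denoising process. For $0\le\eta\le\theta\le1$, $Q_{\eta\to\theta}(x,\cdot)=\Pr[Y_\theta\in\cdot\mid Y_\eta=x]$; $\mu_\theta$ is the law of $Y_\theta$; for $f:\mathcal{X}\to\mathbb{R}_{\ge0}$, $f_\theta(x)=\mathbb{E}_{Q_{\theta\to1}(x,\cdot)}[f]$. $\mathrm{Ent}^\phi_\nu[g]=\mathbb{E}_\nu[\phi(g)]-\phi(\mathbb{E}_\nu[g])$.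 $\mu$ is $\phi$-entropically stable with rate $C$ with respect to $(X_t)$ if for every $\eta\in[0,1]$, every state $x$ and every $f:\mathcal{X}\to\mathbb{R}_{\ge0}$, $$\lim_{\theta\to\eta^+}\frac{1}{\theta-\eta}\mathrm{Ent}^\phi_{Q_{\eta\to\theta}(x,\cdot)}[f_\theta]\le\frac{C(\eta)}{1-\eta}\mathrm{Ent}^\phi_{Q_{\eta\to1}(x,\cdot)}[f].$$
   Formalization: Added since the claim fails otherwise: X is right-continuous in probability; for θ near η the entropy difference quotients are bounded above by a μ_η-integrable function of the state; φ is continuous at 0; C(η)/(1-η) is integrable on [0,θ]. States may be any full-measure set. *)

(* Defs.v *)
From HB Require Import structures.
From mathcomp Require Import all_boot all_order all_algebra.
From mathcomp Require Import all_classical all_reals all_analysis.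

Set Implicit Arguments.
Unset Strict Implicit.
Unset Printing Implicit Defensive.

Import Order.TTheory GRing.Theory Num.Theory.
Import numFieldNormedType.Exports.

Local Open Scope classical_set_scope.
Local Open Scope ring_scope.

(* R^n with its Borel sigma-algebra. *)
Notation rn R n := (g_sigma_algebraType (@open 'rV[R]_n)).

Definition phi_ent d (T : measurableType d) (R : realType) (phi : R -> R)
    (nu : {measure set T -> \bar R}) (g : T -> R) : R :=
  \int[nu]_x phi (g x) - phi (\int[nu]_x g x).

Section Noising.
Context d (Omega : measurableType d) (R : realType) (n : nat).
Variables (P : probability Omega R) (X : R -> {RV P >-> rn R n}).

Definition past (s : R) : set_system Omega :=
  <<s \bigcup_(u in `[0, s]) preimage_set_system setT (X u) measurable >>.

(* [g (X s)] is a version of the conditional probability of [X t \in B] given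
   the past of [s]. Only times in [0, 1] matter. *)
Definition markov : Prop :=
  forall s t : R, 0 <= s -> s <= t -> t <= 1 ->
  forall B : set (rn R n), measurable B ->
  exists g : rn R n -> R,
    [/\ measurable_fun setT g, forall x, 0 <= g x <= 1 &
        forall A : set Omega, past s A ->
          P (A `&` X t @^-1` B) = (\int[P]_(w in A) (g (X s w))%:E)%E].

(* Right-continuity in probability: automatic when the paths are right-continuous
   (in particular cadlag). *)
Definition right_continuous_in_probability : Prop :=
  forall t e : R, 0 <= t -> t < 1 -> 0 < e ->
    P [set w | e <= `|(X s w : 'rV[R]_n) - X t w|] @[s --> t^'+] --> 0%E.

(* The regularity of [X] is necessary: if [X t] is [X 0] for [t <= 1/2] and [0]
   afterwards, then every law on a finite set is stable with rate 0, for every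
   [phi], but entropy is not conserved. *)
Record noising_process (mu : probability (rn R n) R) : Prop := {
  noising_markov : markov;
  noising_regular : right_continuous_in_probability;
  noising_start : forall A, measurable A -> distribution P (X 0) A = mu A;
  noising_end : {ae P, forall w, (X 1 w : 'rV[R]_n) = 0} }.

(* The denoising process; everything below depends on its law only. *)
Definition denoising (theta : R) : {RV P >-> rn R n} := X (1 - theta).

Definition denoising_law (theta : R) : probability (rn R n) R :=
  distribution P (denoising theta).

(* [Q eta theta] is a regular conditional distribution of the denoising process
   at time [theta] given its value at time [eta]. *)
Definition denoising_kernel (Q : R -> R -> R.-pker rn R n ~> rn R n) : Prop :=
  forall eta theta : R, 0 <= eta -> eta <= theta -> theta <= 1 ->
  forall A B : set (rn R n), measurable A -> measurable B ->
    P (denoising eta @^-1` A `&` denoising theta @^-1` B) =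
    (\int[denoising_law eta]_(x in A) Q eta theta x B)%E.

(* [S eta] is the set of states at time [eta]. Conditioning on a point only
   makes sense almost everywhere, so that any set of full measure will do. *)
Definition state_space (S : R -> set (rn R n)) : Prop :=
  forall eta : R, 0 <= eta -> eta <= 1 ->
    measurable (S eta) /\ denoising_law eta (S eta) = 1%E.

Variables (D : set (rn R n)) (Q : R -> R -> R.-pker rn R n ~> rn R n).
Variable S : R -> set (rn R n).
Variable phi : R -> R.

(* A function D -> R_{>=0} is represented by [f : rn R n -> R] with
   [nonneg_on f]; it is always used through [f \_ D], its extension by 0. *)
Definition nonneg_on (f : rn R n -> R) : Prop := forall x, D x -> 0 <= f x.

Definition denoised (f : rn R n -> R) (theta : R) (x : rn R n) : R :=
  \int[Q theta 1 x]_y (f \_ D) y.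

(* Time 1 is left out: there is no time after it, so that the limit is void. *)
Definition entropically_stable (C : R -> R) : Prop :=
  forall eta : R, 0 <= eta -> eta < 1 ->
  forall x, S eta x -> forall f, nonneg_on f ->
  exists l : R,
    (theta - eta)^-1 * phi_ent phi (Q eta theta x) (denoised f theta)
      @[theta --> eta^'+] --> l /\
    l <= C eta / (1 - eta) * phi_ent phi (Q eta 1 x) (f \_ D).

(* The limit in the previous definition is pointwise in [x]; this lets it be
   exchanged with the expectation over [denoising_law eta], which may fail
   otherwise (e.g. with a jump at a time that can be read off the state). *)
Definition dominated_entropy_quotients : Prop :=
  forall eta : R, 0 <= eta -> eta < 1 -> forall f, nonneg_on f ->
  exists2 g : rn R n -> R,
    (denoising_law eta).-integrable setT (EFin \o g) &
    \forall theta \near eta^'+, forall x, S eta x ->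
      (theta - eta)^-1 * phi_ent phi (Q eta theta x) (denoised f theta) <= g x.

Definition approx_entropy_conservation (mu : probability (rn R n) R)
    (K theta : R) : Prop :=
  forall f, nonneg_on f ->
    phi_ent phi mu (f \_ D) <=
    K * \int[denoising_law theta]_x phi_ent phi (Q theta 1 x) (f \_ D).

End Noising.

(* Main.v *)
(* Write M_t = f_t(Y_t) and u(t) = E[Ent_{Q_{t->1}(Y_t, .)} f].  Since f_t(Y_t) is
   the conditional expectation of f(Y_1) given Y_t, u(t) = E phi(f(Y_1)) -
   E phi(M_t), u(0) = Ent_mu f because Y_0 = 0 almost surely, and the Markov
   property gives u(s) - u(t) = E[Ent_{Q_{s->t}(Y_s, .)} f_t] for s <= t.
   Dominated convergence turns entropic stability into a one-sided differential
   inequality: the upper right Dini derivative of - u at s is at most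
   C(s) / (1 - s) * u(s).  As C is merely integrable, Gronwall's lemma is proved
   by comparison with the integral of a lower semicontinuous majorant of
   C(s) / (1 - s); it needs u to have no jump from the left.  This holds because
   Y_t -> Y_s in probability as t increases to s, so that M_s is an L^2 limit of
   functions of Y_t, while M_t is the L^2 projection of M_s on these functions. *)

Require Import Defs.
From HB Require Import structures.
From mathcomp Require Import all_boot all_order all_algebra.
From mathcomp Require Import all_classical all_reals all_analysis.
From mathcomp Require Import measurable_realfun.
From mathcomp Require Import ring lra.

Set Implicit Arguments.
Unset Strict Implicit.
Unset Printing Implicit Defensive.

Import Order.TTheory GRing.Theory Num.Theory.
Import numFieldNormedType.Exports.

Local Open Scope classical_set_scope.
Local Open Scope ring_scope.

(** The kernels are conditional laws only up to null sets, so an identity such as Chapman-Kolmogorov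
    may fail at individual states. Identities are therefore proved as equalities of integrals
    against bounded test functions, and exploited through vanishing L^2 distances. As [D] is finite,
    every function built from [f] is bounded and measurable; an integral identity between such
    functions is checked on indicators and extended by linearity and uniform limits. On the
    half-line [phi] is only known to be convex and continuous, possibly with infinite slope at 0, so
    L^2 closeness is carried through it by a bound [|psi a - psi b| <= e + K * (a - b) ^+ 2] on
    bounded intervals. Jumps from the left must be excluded because u is nonincreasing and stability
    only looks to the right of each time: entropy lost in a jump u(s-) > u(s) is invisible to all
    right derivatives. Under time reversal, right-continuity of [X] is exactly what controls Y from
    the left. *)

Definition bounded_measurable d (T : measurableType d) (R : realType)
    (g : T -> R) : Prop :=
  measurable_fun setT g /\ exists b, forall x, `|g x| <= b.

(** * Bounded measurable functions and their integrals *)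

Section BoundedMeasurable.
Context d (T : measurableType d) (R : realType).
Implicit Types (g h : T -> R) (A : set T).

Lemma bounded_measurable_cst (c : R) :
  bounded_measurable (fun _ : T => c).
Proof. by split; [exact: measurable_cst | exists `|c|]. Qed.

Lemma bounded_measurable_indic A : measurable A ->
  bounded_measurable (\1_A : T -> R).
Proof.
move=> mA; split; first exact: measurable_indic.
by exists 1 => x; rewrite indicE; case: (_ \in _); rewrite ?normr1 ?normr0.
Qed.

Lemma bounded_measurableD g h : bounded_measurable g -> bounded_measurable h ->
  bounded_measurable (fun x => g x + h x).
Proof.
move=> [mg [b gb]] [mh [c hc]]; split; first exact: measurable_funD.
by exists (b + c) => x; rewrite (le_trans (ler_normD _ _))// lerD.
Qed.

Lemma bounded_measurableM g h : bounded_measurable g -> bounded_measurable h ->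
  bounded_measurable (fun x => g x * h x).
Proof.
move=> [mg [b gb]] [mh [c hc]]; split; first exact: measurable_funM.
by exists (b * c) => x; rewrite normrM ler_pM.
Qed.

Lemma bounded_measurableZ (a : R) g : bounded_measurable g ->
  bounded_measurable (fun x => a * g x).
Proof. exact: (bounded_measurableM (bounded_measurable_cst a)). Qed.

Lemma bounded_measurableB g h : bounded_measurable g -> bounded_measurable h ->
  bounded_measurable (fun x => g x - h x).
Proof.
move=> bg bh; rewrite [X in bounded_measurable X](_ : _ =
  fun x => g x + -1 * h x); last by apply/funext => x; rewrite mulN1r.
by apply: bounded_measurableD => //; exact: bounded_measurableZ.
Qed.

Lemma bounded_measurableX2 g : bounded_measurable g ->
  bounded_measurable (fun x => g x ^+ 2).
Proof. by move=> bg; apply: bounded_measurableM. Qed.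

Lemma bounded_measurable_sum (I : Type) (s : seq I) (F : I -> T -> R) :
  (forall i, bounded_measurable (F i)) ->
  bounded_measurable (fun x => \sum_(i <- s) F i x).
Proof.
move=> bF; elim: s => [|i s IH].
  rewrite [X in bounded_measurable X](_ : _ = fun=> 0).
    exact: bounded_measurable_cst.
  by apply/funext => x; rewrite big_nil.
rewrite [X in bounded_measurable X](_ : _ =
  fun x => F i x + \sum_(j <- s) F j x).
  exact: bounded_measurableD.
by apply/funext => x; rewrite big_cons.
Qed.

Lemma bounded_measurable_comp d' (U : measurableType d') (k : U -> R)
    (X : T -> U) : measurable_fun setT X -> bounded_measurable k ->
  bounded_measurable (k \o X).
Proof.
move=> mX [mk [b kb]]; split; first exact: measurableT_comp.
by exists b => x; exact: kb.
Qed.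

(** A functional monotone class principle with uniform instead of monotone limits: rounding a
    bounded function down to a grid of mesh [e] gives a finite combination of indicators within [e]
    of it. The properties to be propagated are then only required to be stable under uniform
    limits. *)
Lemma bounded_measurable_ind (Pr : (T -> R) -> Prop) :
  (forall A, measurable A -> Pr (\1_A)) ->
  (forall (a : R) g h, bounded_measurable g -> bounded_measurable h ->
    Pr g -> Pr h -> Pr (fun x => a * g x + h x)) ->
  (forall g, bounded_measurable g ->
    (forall e : R, 0 < e -> exists h,
      [/\ bounded_measurable h, Pr h & forall x, `|g x - h x| <= e]) -> Pr g) ->
  forall g, bounded_measurable g -> Pr g.
Proof.
move=> Pindic Plin Punif.
have bm0 := bounded_measurable_cst (0 : R).
have P0 : Pr (fun=> 0).
  rewrite (_ : (fun=> 0) = \1_set0 :> (T -> R)); first exact: Pindic.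
  by apply/funext => x; rewrite indic0.
have P1 c : Pr (fun=> c).
  rewrite (_ : (fun=> c) = (fun x => c * \1_[set: T] x + 0) :> (T -> R)).
    by apply: Plin => //; [exact: bounded_measurable_indic | exact: Pindic].
  by apply/funext => x; rewrite indicT mulr1 addr0.
have Psum (s : seq nat) (a : nat -> R) (B : nat -> set T) :
    (forall i, measurable (B i)) -> Pr (fun x => \sum_(i <- s) a i * \1_(B i) x).
  move=> mB; elim: s => [|i s IH].
    rewrite [X in Pr X](_ : _ = fun=> 0) //.
    by apply/funext => x; rewrite big_nil.
  rewrite [X in Pr X](_ : _ =
    fun x => a i * \1_(B i) x + \sum_(j <- s) a j * \1_(B j) x).
    apply: Plin => //; [exact: bounded_measurable_indic | | exact: Pindic].
    apply: bounded_measurable_sum => j.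
    exact/bounded_measurableZ/bounded_measurable_indic.
  by apply/funext => x; rewrite big_cons.
move=> g [mg [b gb]]; apply: Punif; first by split => //; exists b.
move=> e e0.
pose N := (Num.truncn (2 * b / e)).+1.
(* A bound of [|g x|] can be negative only when there is no [x] at all. *)
have b0 : 0 <= b \/ forall x : T, False.
  have [[x _]|nx] := pselect (exists x : T, True).
    by left; exact: le_trans (gb x).
  by right=> x; apply: nx; exists x.
case: b0 => [b0|noT]; last first.
  by exists (fun=> 0); split => // x; case: (noT x).
(* [y - e < e * #{i | (i + 1) e <= y} <= y] for [y = g x + b >= 0] *)
pose B (i : nat) := [set x : T | i.+1%:R * e <= g x + b].
have mB i : measurable (B i).
  rewrite (_ : B i = g @^-1` `[i.+1%:R * e - b, +oo[).
    by rewrite -[X in measurable X]setTI; exact: mg.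
  apply/seteqP; split => x /=; rewrite in_itv/= andbT lerBlDr//.
(* The factor [1] gives the function the shape [a * g x + h x] that [Plin] expects; [- b] undoes the
   shift that made [g] nonnegative. *)
exists (fun x => 1 * (\sum_(i <- iota 0 N) e * \1_(B i) x) + - b); split.
- apply: bounded_measurableD; last exact: bounded_measurable_cst.
  apply: bounded_measurableZ; apply: bounded_measurable_sum => j.
  exact/bounded_measurableZ/bounded_measurable_indic.
- apply: Plin => //; [|exact: bounded_measurable_cst|exact: Psum].
  apply: bounded_measurable_sum => j.
  exact/bounded_measurableZ/bounded_measurable_indic.
- move=> x; rewrite mul1r opprD opprK addrA addrAC.
  have y0 : 0 <= g x + b by have := gb x; rewrite ler_norml => /andP[]; lra.
  have y1 : g x + b <= 2 * b by have := gb x; rewrite ler_norml => /andP[]; lra.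
  set y := g x + b in y0 y1 *.
  pose m := Num.truncn (y / e).
  have ye0 : 0 <= y / e by rewrite divr_ge0// ltW.
  have /andP[m1 m2] := truncn_itv ye0.
  have mN : (m < N)%N by rewrite ltnS le_truncn// ler_pM2r ?invr_gt0.
  suff -> : \sum_(i <- iota 0 N) e * \1_(B i) x = m%:R * e.
    move: m1 m2; rewrite -/m ler_pdivlMr// ltr_pdivrMr// => m1 m2.
    by rewrite ger0_norm ?subr_ge0//; move: m2; rewrite -natr1; lra.
  have BE i : \1_(B i) x = (i < m)%:R :> R.
    rewrite indicE; congr (_%:R); congr nat_of_bool.
    apply/idP/idP => [|im].
      rewrite inE /B/= -/y -ler_pdivlMr// => h.
      by rewrite /m truncn_ge_nat.
    rewrite inE /B/= -/y -ler_pdivlMr// (le_trans _ m1)// ler_nat//.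
  under eq_bigr do rewrite BE.
  rewrite -/(index_iota 0 N) (big_cat_nat (n := m))//=; last exact: ltnW.
  rewrite [X in X + _](_ : _ = \sum_(0 <= i < m) e); last first.
    by apply: eq_big_nat => i /andP[_ ->]; rewrite mulr1.
  rewrite [X in _ + X](_ : _ = 0); last first.
    rewrite big_nat_cond big1// => i /andP[/andP[mi _] _].
    by rewrite ltnNge mi mulr0.
  by rewrite addr0 sumr_const_nat subn0 mulr_natl.
Qed.

Variable P : probability T R.

Lemma bounded_measurable_integrable g A : measurable A -> bounded_measurable g ->
  P.-integrable A (EFin \o g).
Proof.
move=> mA [mg [b gb]].
apply: (@le_integrable _ _ _ P A mA _ (EFin \o cst b)).
- by apply/measurable_EFinP; exact: measurable_funTS.
- by move=> x _ /=; rewrite lee_fin (le_trans (gb x))// ler_norm.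
- exact: finite_measure_integrable_cst.
Qed.

Lemma bRintegralD g h : bounded_measurable g -> bounded_measurable h ->
  \int[P]_x (g x + h x) = \int[P]_x g x + \int[P]_x h x.
Proof.
by move=> bg bh; rewrite RintegralD//; exact: bounded_measurable_integrable.
Qed.

Lemma bRintegralB g h : bounded_measurable g -> bounded_measurable h ->
  \int[P]_x (g x - h x) = \int[P]_x g x - \int[P]_x h x.
Proof.
by move=> bg bh; rewrite RintegralB//; exact: bounded_measurable_integrable.
Qed.

Lemma bRintegralZ (a : R) g : bounded_measurable g ->
  \int[P]_x (a * g x) = a * \int[P]_x g x.
Proof.
by move=> bg; rewrite RintegralZl//; exact: bounded_measurable_integrable.
Qed.

Lemma bRintegral_cst (c : R) : \int[P]_x c = c.
Proof. by rewrite Rintegral_cst// [X in fine X]probability_setT mulr1. Qed.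

Lemma ble_Rintegral g h : bounded_measurable g -> bounded_measurable h ->
  (forall x, g x <= h x) -> \int[P]_x g x <= \int[P]_x h x.
Proof.
move=> bg bh gh.
by apply: le_Rintegral => //; exact: bounded_measurable_integrable.
Qed.

Lemma bRintegral_indic A : measurable A -> \int[P]_x \1_A x = fine (P A).
Proof. by move=> mA; rewrite /Rintegral integral_indic// setIT. Qed.

Lemma bRintegral_close g h e : bounded_measurable g -> bounded_measurable h ->
  (forall x, `|g x - h x| <= e) -> `|\int[P]_x g x - \int[P]_x h x| <= e.
Proof.
move=> bg bh ghe.
rewrite -bRintegralB// (le_trans (le_normr_Rintegral _ _))//.
  by apply: bounded_measurable_integrable => //; exact: bounded_measurableB.
rewrite -[leRHS]bRintegral_cst; apply: ble_Rintegral => //.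
- have [mB [b Bb]] := bounded_measurableB bg bh.
  split; first exact: (measurableT_comp (@normr_measurable _ setT)).
  by exists b => x; rewrite normr_id.
- exact: bounded_measurable_cst.
Qed.

End BoundedMeasurable.

(** * Continuous and convex functions on the half-line; Jensen's inequality *)

Section ConvexFunctions.
Context (R : realType).
Implicit Types (phi psi : R -> R).

(** Nothing is known of [phi] at negative arguments. Composing with the retraction of the line onto
    the half-line yields a function that is continuous everywhere and agrees with [phi] wherever the
    entropy evaluates it. *)
Lemma continuous_comp_max0 phi : {within `[0, +oo[%classic, continuous phi} ->
  continuous (fun x : R => phi (Num.max x 0)).
Proof.
move=> /subspace_continuousP cphi x.
have Dmax (y : R) : `[0, +oo[%classic (Num.max y 0).
  by rewrite /= in_itv/= andbT le_max lexx orbT.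
have cmax : {for x, continuous (fun y : R => Num.max y 0)}.
  by apply: continuous_max; [exact: cvg_id | exact: cvg_cst].
move=> A /(cphi _ (Dmax x)) phiA.
have h : nbhs x [set y : R | `[0, +oo[%classic (Num.max y 0) ->
    A (phi (Num.max y 0))] by exact: cmax phiA.
change (nbhs x [set y : R | A (phi (Num.max y 0))]).
by apply: filterS h => y; apply; exact: Dmax.
Qed.

(* Uniform continuity on [-B, B], in a form that can be integrated against an
   L^2 bound. *)
Lemma continuous_quadratic_modulus psi (B e : R) : continuous psi -> 0 < e ->
  exists2 K, 0 <= K & forall a b, `|a| <= B -> `|b| <= B ->
    `|psi a - psi b| <= e + K * (a - b) ^+ 2.
Proof.
move=> cpsi e0.
have cK : compact `[-B, B]%classic := @segment_compact _ _ _.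
have inB a : `|a| <= B -> `[-B, B]%classic a.
  by rewrite /= in_itv/= ler_norml.
have [M M0 HM] : exists2 M, 0 <= M & forall a, `|a| <= B -> `|psi a| <= M.
  have : compact (psi @` `[-B, B]%classic).
    by apply: continuous_compact => //; exact: continuous_subspaceT.
  move=> /compact_bounded[M [_ HM]].
  exists (`|M| + 1); first by rewrite addr_ge0.
  move=> a /inB Ba; apply: (HM (`|M| + 1)).
    by rewrite (le_lt_trans (ler_norm _))// ltrDl.
  by exists a.
have [r r0 Hr] : exists2 r, 0 < r &
    forall a b, `|a| <= B -> `|b - a| < r -> `|psi a - psi b| <= e.
  (* The near-covering form of compactness turns a radius that works near each point into one radius
     for the whole segment. *)
  have /compact_near_coveringP/(_ _ (0 : R)^'+ (fun r a =>
    forall b, `|b - a| < r -> `|psi a - psi b| <= e)) := cK.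
  case/(_ _ _).
  - move=> x _.
    have /cvgrPdist_lt/(_ _ (divr_gt0 e0 (@ltr0Sn R 1))) := cpsi x.
    move=> /nbhs_ballP[s /= s0 Hs].
    have s20 : 0 < s / 2 by rewrite divr_gt0.
    exists (ball x (s / 2), [set r | r < s / 2]) => /=.
      split; first exact: nbhsx_ballx.
      exact: nbhs_right_lt.
    move=> -[a t] /= [xa ts] b bat.
    have xas : `|psi x - psi a| < e / 2.
      by apply: Hs; apply: le_ball xa; lra.
    have xbs : `|psi x - psi b| < e / 2.
      apply: Hs; rewrite -ball_normE/=; move: xa; rewrite -ball_normE/= => xa.
      rewrite (_ : x - b = (x - a) - (b - a)); last by ring.
      by rewrite (le_lt_trans (ler_normB _ _))//; lra.
    rewrite (_ : psi a - psi b = (psi x - psi b) - (psi x - psi a)); last by ring.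
    by rewrite (le_trans (ler_normB _ _))//; lra.
  - move=> r /= r0 Hr; exists (r / 2); first by rewrite divr_gt0.
    move=> a b /inB aB bar; apply: (Hr (r / 2)) => //=.
      by rewrite sub0r normrN gtr0_norm ?divr_gt0//; lra.
    by rewrite divr_gt0.
have K0 : 0 <= 2 * M / r ^+ 2 by apply: divr_ge0; [exact: mulr_ge0 | exact: sqr_ge0].
(* Arguments closer than [r] differ by at most [e] after [psi]; otherwise [(a - b) ^+ 2 >= r ^+ 2],
   and this [K] makes the quadratic term exceed the trivial bound [2 * M]. *)
exists (2 * M / r ^+ 2) => //.
move=> a b aB bB; have [abr|abr] := ltP `|b - a| r.
  by rewrite (le_trans (Hr _ _ aB abr))// lerDl mulr_ge0 ?sqr_ge0.
apply: (@le_trans _ _ (2 * M)).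
  by rewrite (le_trans (ler_normB _ _))// mulr2n mulrDl mul1r lerD// HM.
rewrite -[leLHS]add0r; apply: lerD; first exact: ltW.
rewrite mulrAC ler_pdivlMr ?exprn_gt0// ler_wpM2l ?mulr_ge0//.
by rewrite -(real_normK (num_real (a - b))) distrC lerXn2r// nnegrE ltW.
Qed.

Lemma convex_chord phi : convex_function (`[0, +oo[%classic : set R) phi ->
  forall x y z : R, 0 <= x -> x < y -> y < z ->
  phi y * (z - x) <= phi x * (z - y) + phi z * (y - x).
Proof.
move=> cphi x y z x0 xy yz.
have zx : 0 < z - x by lra.
have t0 : 0 <= (z - y) / (z - x) by rewrite divr_ge0; lra.
have t1 : (z - y) / (z - x) <= 1 by rewrite ler_pdivrMr//; lra.
have := cphi (Itv01 t0 t1) x z.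
rewrite !inE/= !in_itv/= !andbT => /(_ x0 (ltW (le_lt_trans x0 (lt_trans xy yz)))).
rewrite !convRE/= /unstable.onem.
have -> : conv (Itv01 t0 t1) (x : convex_lmodType R^o) z = y.
  by rewrite [LHS]convRE/= /unstable.onem; field; rewrite gt_eqF.
rewrite -(ler_pM2r zx); congr (_ <= _); field; by rewrite gt_eqF.
Qed.

(** The slope is the supremum of the slopes of the chords that end at [m] from the left, which all
    lie below those of the chords that start at [m]. At [m = 0] there may be no supporting line, as
    for x log x. *)
Lemma convex_support phi : convex_function (`[0, +oo[%classic : set R) phi ->
  forall m, 0 < m -> exists a, forall x, 0 <= x ->
  phi m + a * (x - m) <= phi x.
Proof.
move=> /convex_chord cphi m m0.
pose A := [set (phi m - phi x) / (m - x) | x in [set x | 0 <= x < m]].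
have A0 : A !=set0 by exists ((phi m - phi 0) / (m - 0)), 0; rewrite //= lexx.
have Aub z : m < z -> ubound A ((phi z - phi m) / (z - m)).
  move=> mz _ [x /= /andP[x0 xm] <-].
  rewrite ler_pdivrMr ?subr_gt0// mulrAC ler_pdivlMr ?subr_gt0//.
  by have := cphi _ _ _ x0 xm mz; lra.
have supA : has_sup A.
  by split => //; exists ((phi (m + 1) - phi m) / (m + 1 - m)); apply: Aub; lra.
exists (sup A) => x x0; have [xm|mx|->] := ltgtP x m.
- have : (phi m - phi x) / (m - x) <= sup A.
    by apply: sup_upper_bound => //; exists x => //=; rewrite x0.
  by rewrite ler_pdivrMr ?subr_gt0//; lra.
- have : sup A <= (phi x - phi m) / (x - m) by apply: ge_sup => //; exact: Aub.
  by rewrite ler_pdivlMr ?subr_gt0//; lra.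
- by rewrite subrr mulr0 addr0.
Qed.

Lemma bounded_measurable_comp_continuous d (T : measurableType d) psi
    (g : T -> R) : continuous psi -> bounded_measurable g ->
  bounded_measurable (fun x => psi (g x)).
Proof.
move=> cpsi [mg [b gb]]; split.
  apply: measurableT_comp mg; exact: continuous_measurable_fun.
(* Applied with second argument 0, the modulus also bounds [psi] on [[-b, b]]. *)
have [K K0 HK] := @continuous_quadratic_modulus psi b 1 cpsi ltr01.
exists (1 + K * b ^+ 2 + `|psi 0|) => x.
have b0 : 0 <= b := le_trans (normr_ge0 _) (gb x).
have := HK (g x) 0 (gb x); rewrite normr0 subr0 => /(_ b0) h.
rewrite -[psi (g x)](subrK (psi 0)) (le_trans (ler_normD _ _))// lerD2r.
rewrite (le_trans h)// lerD2l ler_wpM2l//.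
by rewrite -(real_normK (num_real (g x))) lerXn2r// nnegrE.
Qed.

(** [K] is chosen before [g] and [h]: it depends only on [psi], [b] and [e], so that it can serve a
    whole family of uniformly bounded functions. *)
Lemma Rintegral_modulus d (T : measurableType d) (P : probability T R) psi
    (b e : R) : continuous psi -> 0 < e ->
  exists2 K, 0 <= K & forall g h : T -> R,
    bounded_measurable g -> bounded_measurable h ->
    (forall x, `|g x| <= b) -> (forall x, `|h x| <= b) ->
    `|\int[P]_x psi (g x) - \int[P]_x psi (h x)| <=
    e + K * \int[P]_x (g x - h x) ^+ 2.
Proof.
move=> cpsi e0; have [K K0 HK] := continuous_quadratic_modulus b cpsi e0.
exists K => // g h bg bh gb hb.
have bpg := bounded_measurable_comp_continuous cpsi bg.
have bph := bounded_measurable_comp_continuous cpsi bh.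
have bcst := bounded_measurable_cst T e.
have bK := bounded_measurableZ K (bounded_measurableX2 (bounded_measurableB bg bh)).
have bs := bounded_measurableD bcst bK.
have -> : e + K * \int[P]_x (g x - h x) ^+ 2 = \int[P]_x (e + K * (g x - h x) ^+ 2).
  rewrite bRintegralD ?bRintegral_cst ?bRintegralZ//.
  exact/bounded_measurableX2/bounded_measurableB.
have pt x : `|psi (g x) - psi (h x)| <= e + K * (g x - h x) ^+ 2 by exact: HK.
rewrite ler_norml -bRintegralB//; apply/andP; split.
- rewrite lerNl -[leLHS]mulN1r -bRintegralZ; last exact: bounded_measurableB.
  apply: ble_Rintegral => //; first exact/bounded_measurableZ/bounded_measurableB.
  by move=> x; have := pt x; rewrite ler_norml => /andP[]; lra.
- apply: ble_Rintegral => //; first exact: bounded_measurableB.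
  by move=> x; have := pt x; rewrite ler_norml => /andP[]; lra.
Qed.

(** Integrating the supporting line at the mean proves it when the mean is positive. To cover mean
    0, where that line may not exist, [g] is raised by a small constant [s], and continuity removes
    [s]. *)
Lemma jensen d (T : measurableType d) (P : probability T R) phi (g : T -> R) :
  convex_function (`[0, +oo[%classic : set R) phi ->
  {within `[0, +oo[%classic, continuous phi} ->
  bounded_measurable g -> (forall x, 0 <= g x) ->
  phi (\int[P]_x g x) <= \int[P]_x phi (g x).
Proof.
move=> cvphi /continuous_comp_max0 cphi.
pose psi (x : R) := phi (Num.max x 0).
have psiE x : 0 <= x -> phi x = psi x by move=> x0; rewrite /psi max_l.
have main (h : T -> R) : bounded_measurable h -> (forall x, 0 <= h x) ->
    0 < \int[P]_x h x -> psi (\int[P]_x h x) <= \int[P]_x psi (h x).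
  move=> bh h0 m0; have [a Ha] := convex_support cvphi m0.
  set m := \int[P]_x h x in m0 Ha *.
  have bl : bounded_measurable (fun x => phi m + a * (h x - m)).
    apply: bounded_measurableD; first exact: bounded_measurable_cst.
    apply: bounded_measurableZ; apply: bounded_measurableB => //.
    exact: bounded_measurable_cst.
  have : \int[P]_x (phi m + a * (h x - m)) <= \int[P]_x psi (h x).
    apply: ble_Rintegral => //; first exact: bounded_measurable_comp_continuous.
    by move=> x; rewrite -psiE//; exact: Ha.
  rewrite bRintegralD ?bRintegralZ ?bRintegralB ?bRintegral_cst -/m ?subrr
      ?mulr0;
    do ?[exact: bounded_measurable_cst | apply: bounded_measurableZ
       | apply: bounded_measurableB | by []].
  by rewrite addr0 psiE// ltW.
move=> bg g0.
have i0 : 0 <= \int[P]_x g x by apply: Rintegral_ge0.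
have -> : \int[P]_x phi (g x) = \int[P]_x psi (g x).
  by apply: eq_Rintegral => x _; rewrite psiE.
rewrite psiE//.
have [mb [b gb]] := bg.
apply/ler_addgt0Pr => e e0.
have e20 : 0 < e / 4 by rewrite divr_gt0.
have [K K0 HK] := @continuous_quadratic_modulus psi (b + 1) (e / 4) cphi e20.
have [s [s0 s1 Ks]] : exists s, [/\ 0 < s, s <= 1 & K * s ^+ 2 <= e / 4].
  (* The bound 1 keeps [g + s] within [b + 1]; as [s ^+ 2 <= s], the other bound gives
     [K * s ^+ 2 <= e / 4]. Each of the two sides of Jensen then moves by at most [e / 2]. *)
  exists (Num.min 1 (e / (4 * (K + 1)))); split.
  - by rewrite lt_min ltr01 divr_gt0// mulr_gt0// ltr_wpDl.
  - by rewrite ge_min lexx.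
  - set s := Num.min _ _.
    have s1 : s <= 1 by rewrite /s ge_min lexx.
    have s0 : 0 <= s by rewrite /s le_min ler01 divr_ge0//; lra.
    have : s <= e / (4 * (K + 1)) by rewrite /s ge_min lexx orbT.
    rewrite ler_pdivlMr; last by rewrite mulr_gt0// ltr_wpDl.
    have : s ^+ 2 <= s by rewrite expr2 ler_piMr.
    by nra.
have bgs : bounded_measurable (fun x => g x + s).
  by apply: bounded_measurableD => //; exact: bounded_measurable_cst.
have iE : \int[P]_x (g x + s) = \int[P]_x g x + s.
  by rewrite bRintegralD ?bRintegral_cst//; exact: bounded_measurable_cst.
have := main _ bgs; rewrite iE => /(_ _ _)/=.
move=> /(_ (fun x => addr_ge0 (g0 x) (ltW s0))) /(_ (ltr_wpDl i0 s0)) h1.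
have ib : `|\int[P]_x g x| <= b.
  rewrite ger0_norm// -[leRHS](bRintegral_cst P); apply: ble_Rintegral => //.
    exact: bounded_measurable_cst.
  by move=> x; rewrite (le_trans (ler_norm _)).
have closeb x : `|x| <= b -> `|psi (x + s) - psi x| <= e / 2.
  move=> xb; rewrite (le_trans (HK _ _ _ _))//.
  - by rewrite (le_trans (ler_normD _ _))// lerD// gtr0_norm.
  - by rewrite (le_trans xb)// lerDl.
  - rewrite (_ : x + s - x = s); last by ring.
    lra.
have := bRintegral_close P (bounded_measurable_comp_continuous cphi bgs)
  (bounded_measurable_comp_continuous cphi bg) (fun x => closeb _ (gb x)).
have := closeb _ ib.
rewrite -/psi !ler_norml => /andP[h2 h3] /andP[h4 h5].
rewrite /psi in h1 h2 h3 h4 h5 *.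
lra.
Qed.

End ConvexFunctions.

(** * Gronwall's inequality with an integrable rate and a one-sided derivative *)

Section Gronwall.
Context (R : realType).
Implicit Types (u c V : R -> R).

Lemma near_at_rightP (s : R) (Pr : R -> Prop) :
  (\forall t \near s^'+, Pr t) ->
  exists2 r, 0 < r & forall t, s < t -> t < s + r -> Pr t.
Proof.
move=> [r /= r0 Hr]; exists r => // t st tsr; apply: Hr => //=.
by rewrite distrC gtr0_norm ?subr_gt0//; lra.
Qed.

(* A Vitali-Caratheodory argument: [V x] is the integral over [0, x] of a lower
   semicontinuous function above [c], obtained by covering each level set
   [k h <= c < (k + 1) h] by an open set of nearly the same measure. *)
Lemma integrable_majorant c (T e : R) : 0 <= T -> 0 < e ->
  (forall s, 0 <= s <= T -> 0 <= c s) ->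
  lebesgue_measure.-integrable `[0, T] (EFin \o c) ->
  exists V : R -> R,
  [/\ forall s t, 0 <= s -> s <= t -> t <= T -> 0 <= V s <= V t,
      V T <= \int[lebesgue_measure]_(x in `[0, T]) c x + e &
      forall s, 0 <= s -> s < T -> exists2 k, c s < k &
        \forall t \near s^'+, k * (t - s) <= V t - V s].
Proof.
move=> T0 e0 c0 intc.
pose mu : {measure set (measurableTypeR R) -> \bar R} := lebesgue_measure.
pose I : set R := `[0, T]%classic.
have mI : measurable (I : set (measurableTypeR R)) by exact: measurable_itv.
have mc : measurable_fun (I : set (measurableTypeR R)) c.
  by apply/measurable_EFinP; exact: measurable_int intc.
have muI : mu I = T%:E.
  rewrite [LHS](lebesgue_measure_itv `[0, T])/= lte_fin; case: ltP => [_|T0'].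
    by rewrite -EFinD subr0.
  by congr EFin; apply/eqP; rewrite eq_le T0 T0'.
(* Half of [e] pays for rounding [c] up by at most [2 * h] over a length [T], the other half for the
   open covers. *)
pose h := e / (4 * (T + 1)).
have T1 : 0 < T + 1 by rewrite ltr_wpDl.
have h0 : 0 < h by rewrite divr_gt0// mulr_gt0.
have hT : 2 * h * T <= e / 2.
  have -> : e / 2 = 2 * h * (T + 1) by rewrite /h; field; rewrite gt_eqF.
  by rewrite mulrDr mulr1 lerDl; lra.
pose E (k : nat) : set R := I `&` c @^-1` `[k%:R * h, k.+1%:R * h[%classic.
have mE k : measurable (E k : set (measurableTypeR R)) by exact: mc.
have IE x : I x -> exists k, E k x.
  move=> Ix; have cx0 : 0 <= c x by apply: c0; move: Ix; rewrite /I/= in_itv.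
  exists (Num.truncn (c x / h)); split => //=.
  have /truncn_itv : 0 <= c x / h by rewrite divr_ge0// ltW.
  by rewrite in_itv/= ler_pdivlMr// ltr_pdivrMr.
have bigE : \bigcup_k E k = I.
  apply/seteqP; split => [x [k _ []]//|x /IE[k Ekx]]; by exists k.
have tE : trivIset setT E.
  apply/trivIsetP => i j _ _ ij; rewrite -subset0 => x [[_ +] [_ +]] /=.
  rewrite /preimage/= !in_itv/=.
  have trE k : k%:R * h <= c x < k.+1%:R * h -> Num.truncn (c x / h) = k.
    by move=> /andP[k1 k2]; apply: truncn_def; rewrite ler_pdivlMr// ltr_pdivrMr// k1.
  by move=> /trE ix /trE jx; move: ij; rewrite -ix -jx eqxx.
(* One step more than the upper end of the level: [a k] exceeds [c] strictly on [E k], yet is at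
   most [c + 2 * h] there. *)
pose a (k : nat) : R := k.+2%:R * h.
have a0 k : 0 < a k by rewrite mulr_gt0.
have muE k : (mu (E k) < +oo)%E.
  apply: (@le_lt_trans _ _ (mu I)); last by rewrite muI ltry.
  by apply: le_measure; rewrite ?inE//; exact: subIsetl.
(* After weighting by [a k], the excess of [U k] over [E k] is at most [(e / 2) / 2 ^ k.+1], and
   these sum to [e / 2]. *)
have : forall k, exists U : set R,
    [/\ open U, E k `<=` U &
     (mu (U `\` E k) < ((e / 2) / (2 ^ k.+1)%:R / a k)%:E)%E].
  move=> k; apply: lebesgue_regularity_outer; [exact: mE | exact: muE |].
  apply: divr_gt0 => //; apply: divr_gt0; first exact: divr_gt0.
  by rewrite ltr0n expn_gt0.
move=> /choice[U HU].
have mU k : measurable (U k : set (measurableTypeR R)).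
  by apply: open_measurable; case: (HU k).
(* The measure whose density is the sum of [a k] times the indicator of [U k]; each [U k] is open,
   which makes this density lower semicontinuous. *)
pose m : {measure set (measurableTypeR R) -> \bar R} := mseries (fun k =>
  mscale (NngNum (ltW (a0 k))) (mrestr mu (mU k))) 0.
have mEq A : m A = (\sum_(0 <= k <oo) (a k)%:E * mu (A `&` U k))%E by [].
have term0 A k : (0 <= (a k)%:E * mu (A `&` U k))%E.
  by rewrite mule_ge0// lee_fin ltW.
have mI_le : (m I <= (\int[mu]_(x in I) c x + e)%:E)%E.
  have Hk k : ((a k)%:E * mu (I `&` U k) <=
      (a k)%:E * mu (E k) + ((e / 2) / (2 ^ k.+1)%:R)%:E)%E.
    have [oU EU UE] := HU k.
    have sub : (mu (I `&` U k) <= mu (E k) + mu (U k `\` E k))%E.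
      have mUE : measurable (U k `\` E k : set (measurableTypeR R)).
        by exact: measurableD.
      have <- : mu (E k `|` (U k `\` E k)) = (mu (E k) + mu (U k `\` E k))%E.
        by apply: measureU => //; exact: setDIK.
      apply: le_measure; rewrite ?inE; 
        [exact: (measurableI _ _ mI (mU k))|exact: (measurableU _ _ (mE k) mUE)|].
      move=> x [_ Ux]; have [Ex|nEx] := pselect (E k x); [by left|by right].
    rewrite (@le_trans _ _ ((a k)%:E * (mu (E k) + mu (U k `\` E k))))%E//.
      by rewrite lee_pmul2l// lte_fin.
    rewrite muleDr//; last by rewrite ge0_adde_def// inE.
    rewrite leeD2l//.
    apply: (@le_trans _ _ ((a k)%:E * (e / 2 / (2 ^ k.+1)%:R / a k)%:E)%E).
      by rewrite lee_pmul2l ?lte_fin//; exact: ltW.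
    by rewrite -EFinM lee_fin mulrC divfK// gt_eqF.
  rewrite mEq (le_trans (lee_nneseries _ (fun k _ => Hk k)))//.
  rewrite (le_trans (epsilon_trick _ _ _))//.
  - by move=> k; rewrite mule_ge0// lee_fin ltW.
  - by rewrite divr_ge0// ltW.
  have ch0 x : I x -> 0 <= c x + 2 * h.
    rewrite /I/= in_itv/= => /c0; lra.
  have H2 : (\sum_(0 <= k <oo) (a k)%:E * mu (E k) <=
      \int[mu]_(x in I) (c x + 2 * h)%:E)%E.
    rewrite -[in leRHS]bigE ge0_integral_bigcup//; last 2 first.
    - rewrite bigE; apply/measurable_EFinP; apply: measurable_funD => //.
    - by rewrite bigE => x Ix; rewrite lee_fin ch0.
    apply: lee_nneseries => [k _ _|k _]; first by rewrite mule_ge0// lee_fin ltW.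
    rewrite -integral_cst//; apply: ge0_le_integral => //.
    - by move=> x _; rewrite lee_fin ltW.
    - apply/measurable_EFinP; apply: measurable_funD => //.
      by apply: measurable_funS mc => //; exact: subIsetl.
    - move=> x [_]; rewrite /preimage/= in_itv/= => /andP[h1 _]; rewrite lee_fin /a.
      by move: h1; rewrite -(natr1 k.+1) -natr1; lra.
  have intI2 : mu.-integrable I (EFin \o cst (2 * h)).
    apply/integrableP; split; first exact/measurable_EFinP.
    rewrite (_ : (fun x => _) = cst (2 * h)%:E).
      by rewrite integral_cst// [X in (_ * X)%E]muI -EFinM ltry.
    by apply/funext => x /=; rewrite ger0_norm// ltW// mulr_gt0.
  rewrite (le_trans (leeD2r _ H2))//.
  under eq_integral do rewrite EFinD.
  rewrite integralD//= integral_cst//= muI EFinD /Rintegral fineK; last first.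
    exact: integrable_fin_num.
  by rewrite -addeA leeD2l// -EFinM -EFinD lee_fin; lra.
have mfin A : measurable A -> A `<=` I -> m A \is a fin_num.
  move=> mA AI; rewrite ge0_fin_numE//.
  rewrite (le_lt_trans _ (ltry (\int[mu]_(x in I) c x + e)))//.
  by rewrite (le_trans _ mI_le)//; apply: le_measure; rewrite ?inE.
have subI s t : 0 <= s -> t <= T -> `[s, t]%classic `<=` I.
  move=> s0 tT x; rewrite /I/= !in_itv/= => /andP[sx xt].
  by rewrite (le_trans s0)//= (le_trans xt).
exists (fun x => fine (m `[0, x]%classic)); split.
- move=> s t s0 st tT; rewrite fine_ge0//= fine_le//.
  + by apply: mfin => //; apply: subI => //; exact: le_trans tT.
  + by apply: mfin => //; exact: subI.
  + apply: le_measure; rewrite ?inE//.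
    by apply: subset_itvl; rewrite bnd_simp.
- by rewrite -lee_fin fineK//; exact: mfin.
- move=> s s0 sT.
  have Is : I s by rewrite /I/= in_itv/= s0 ltW.
  (* Since [U k] is a neighbourhood of [s], it contains []s, t]] for [t] close to [s], and the
     [k]-th term of [m] alone gives this interval mass [a k * (t - s)]. *)
  have [k Eks] := IE s Is; exists (a k).
    have [_ /=] := Eks; rewrite in_itv/= => /andP[_ csk].
    by apply: (lt_le_trans csk); rewrite /a ler_pM2r// ler_nat.
  have [oU EU _] := HU k.
  have /nbhs_ballP[r /= r0 sU] : nbhs s (U k).
    by apply: open_nbhs_nbhs; split => //; exact: EU.
  near=> t.
  have st : s < t by near: t; exact: nbhs_right_gt.
  have tT : t < T by near: t; exact: nbhs_right_lt.
  have tr : t < s + r by near: t; apply: nbhs_right_lt; rewrite ltrDl.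
  have split_itv : `[0, t]%classic = `[0, s]%classic `|` `]s, t]%classic :> set R.
    apply/seteqP; split => x /=; rewrite !in_itv/=.
      by move=> /andP[-> ->]; case: (leP x s) => _; [left|right].
    by case=> /andP[x1 x2]; apply/andP; split; lra.
  have sub : `]s, t]%classic `<=` I.
    apply: subset_trans (subI s t s0 (ltW tT)).
    by apply: subset_itvr; rewrite bnd_simp.
  rewrite split_itv measureU//; last first.
    rewrite -subset0 => x [] /=; rewrite !in_itv/= => /andP[_ xs] /andP[sx _].
    by move: (lt_le_trans sx xs); rewrite ltxx.
  rewrite fineD; [|by apply: mfin => //; apply: subI => //; exact: ltW|exact: mfin].
  rewrite addrAC subrr add0r -lee_fin fineK; last exact: mfin.
  suff : ((a k * (t - s))%:E <= m `]s, t]%classic)%E by [].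
  rewrite mEq; apply: le_trans (nneseries_lim_ge k.+1 _) => //.
  rewrite big_nat_recr//= -[leLHS]add0e; apply: leeD.
    by apply: sume_ge0 => i _; exact: term0.
  rewrite setIidl.
    rewrite [X in (_ * X)%E](lebesgue_measure_itv `]s, t])/=.
    by rewrite lte_fin st -EFinD -EFinM.
  move=> x /=; rewrite in_itv/= => /andP[sx xt]; apply: sU => /=.
  by rewrite -ball_normE/= distrC gtr0_norm ?subr_gt0//; lra.
Unshelve. all: by end_near.
Qed.

(** Continuous induction on the times up to which [expR (- V r) * u 0 <= u r]. Left limits put the
    supremum [s] of these times among them, and if [s < T] the Dini bound carries the inequality
    past [s]. *)
Lemma gronwall_dini u c (T : R) : 0 <= T ->
  (forall s, 0 <= s <= T -> 0 <= c s) ->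
  lebesgue_measure.-integrable `[0, T] (EFin \o c) ->
  (forall s, 0 <= s <= T -> 0 <= u s) ->
  (forall s k, 0 <= s -> s < T -> c s < k ->
    \forall t \near s^'+, u s - u t <= k * u s * (t - s)) ->
  (forall s, 0 < s -> s <= T -> u t @[t --> s^'-] --> u s) ->
  u 0 <= expR (\int[lebesgue_measure]_(x in `[0, T]) c x) * u T.
Proof.
move=> T0 c0 intc u0 dini lcont.
set J := \int[lebesgue_measure]_(x in `[0, T]) c x.
have u00 : 0 <= u 0 by apply: u0; rewrite lexx.
have uT0 : 0 <= u T by apply: u0; rewrite lexx andbT.
have main e : 0 < e -> expR (- (J + e)) * u 0 <= u T.
  move=> e0; have [V [Vmono VT Vgrow]] := integrable_majorant T0 e0 c0 intc.
  suff H : expR (- V T) * u 0 <= u T.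
    by apply: le_trans H; rewrite ler_wpM2r// ler_expR lerN2.
  pose A := [set t | 0 <= t <= T /\
    forall r, 0 <= r -> r <= t -> expR (- V r) * u 0 <= u r].
  have A0 : A 0.
    split; first by rewrite lexx.
    move=> r r0 r0'; have -> : r = 0 by apply/eqP; rewrite eq_le r0 r0'.
    rewrite -[leRHS]mul1r ler_wpM2r// -expR0 ler_expR oppr_le0.
    by have /andP[] := Vmono 0 0 (lexx _) (lexx _) T0.
  have supA : has_sup A by split; [exists 0 | exists T => t [/andP[_ tT] _]].
  pose s := sup A.
  have s0 : 0 <= s by exact: sup_upper_bound.
  have sT : s <= T by apply: ge_sup; [exists 0 | move=> t [/andP[_ tT] _]].
  have below r : 0 <= r -> r < s -> expR (- V r) * u 0 <= u r.
    move=> r0 rs; have sr0 : 0 < s - r by rewrite subr_gt0.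
    have [t [_ At]] := sup_adherent sr0 supA.
    by rewrite -/s subKr => rt; apply: At => //; exact: ltW.
  have At_s : expR (- V s) * u 0 <= u s.
    have [s_eq0|s_neq0] := eqVneq s 0; first by rewrite s_eq0; case: A0 => _; exact.
    have s_gt0 : 0 < s by rewrite lt_neqAle eq_sym s_neq0.
    (* Only [u] passes to the limit; for [V], monotonicity suffices, since
       [expR (- V s) <= expR (- V r)] for [r < s]. *)
    apply: (cvgr_to_ge (lcont s s_gt0 sT)).
    near=> r.
    have r0 : 0 <= r by near: r; exact: nbhs_left_ge.
    have rs : r < s by near: r; exact: nbhs_left_lt.
    apply: le_trans (below r r0 rs); rewrite ler_wpM2r// ler_expR lerN2.
    by have /andP[] := Vmono r s r0 (ltW rs) sT.
  have [s_eqT|s_neqT] := eqVneq s T; first by rewrite -s_eqT.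
  have {s_neqT}sT' : s < T by rewrite lt_neqAle s_neqT.
  have us0 : 0 <= u s by apply: u0; rewrite s0.
  have cs0 : 0 <= c s by apply: c0; rewrite s0.
  exfalso.
  have [k2 ck2 Vk2] := Vgrow s s0 sT'.
  (* Two rates are needed: [u] falls at rate at most [k1] and [V] grows at rate at least [k2]. With
     x = t - s, (1 + k2 x)(1 - k1 x) = 1 + x (k2 - k1 - k1 k2 x), so the gap [k2 - k1] absorbs the
     second-order term as soon as x <= (k2 - k1) / (k1 k2). *)
  pose k1 := (c s + k2) / 2.
  have ck1 : c s < k1 by rewrite /k1; lra.
  have k12 : k1 < k2 by rewrite /k1; lra.
  have k10 : 0 < k1 by exact: le_lt_trans ck1.
  have k20 : 0 < k2 by exact: lt_trans k12.
  have [r r0 Hr] : exists2 r, 0 < r & forall t, s < t -> t < s + r ->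
      t <= T /\ expR (- V t) * u 0 <= u t.
    apply: near_at_rightP; near=> t.
    have st : s < t by near: t; exact: nbhs_right_gt.
    have tT : t < T by near: t; exact: nbhs_right_lt.
    split; first exact: ltW.
    have h1 : u s - u t <= k1 * u s * (t - s) by near: t; exact: dini.
    have h2 : k2 * (t - s) <= V t - V s by near: t.
    have h3 : t < s + (k2 - k1) / (k1 * k2).
      near: t; apply: nbhs_right_lt; rewrite ltrDl.
      by apply: divr_gt0; [lra | exact: mulr_gt0].
    have ut0 : 0 <= u t by apply: u0; rewrite (le_trans s0) ltW.
    have h4 : k1 * k2 * (t - s) <= k2 - k1.
      by rewrite mulrC -ler_pdivlMr ?mulr_gt0//; lra.
    have h5 : u s <= expR (k2 * (t - s)) * u t.
      have : (1 + k2 * (t - s)) * u t <= expR (k2 * (t - s)) * u t.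
        by rewrite ler_wpM2r// expR_ge1Dx.
      apply: le_trans.
      have p1 : 0 <= 1 + k2 * (t - s) by rewrite addr_ge0// mulr_ge0; lra.
      have : (1 + k2 * (t - s)) * (u s - k1 * u s * (t - s)) <=
             (1 + k2 * (t - s)) * u t by rewrite ler_wpM2l//; lra.
      apply: le_trans.
      have -> : (1 + k2 * (t - s)) * (u s - k1 * u s * (t - s)) =
        u s + u s * (t - s) * ((k2 - k1) - k1 * k2 * (t - s)) by ring.
      rewrite lerDl; apply: mulr_ge0; last lra.
      by apply: mulr_ge0 => //; lra.
    have h6 : expR (- V t) <= expR (- V s) * expR (- (k2 * (t - s))).
      by rewrite -expRD ler_expR; lra.
    rewrite (@le_trans _ _ (expR (- V s) * expR (- (k2 * (t - s))) * u 0))//.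
      by rewrite ler_wpM2r.
    rewrite mulrAC [X in _ * X]expRN ler_pdivrMr ?expR_gt0// [leRHS]mulrC.
    exact: le_trans At_s h5.
  have : A (s + r / 2).
    split.
      by have [] := Hr (s + r / 2) _ _; [lra|lra|]; move=> ? _; apply/andP; split; lra.
    move=> q q0 qs; have [qs'|sq|->] := ltgtP q s => //; first exact: below.
    by have [] := Hr q sq; [lra|].
  move=> /(sup_upper_bound supA); rewrite -/s; lra.
suff : expR (- J) * u 0 <= u T.
  by rewrite expRN mulrC ler_pdivrMr ?expR_gt0// mulrC.
apply/ler_addgt0Pr => e e0.
set q := expR (- J) * u 0.
have q0 : 0 <= q by rewrite mulr_ge0// expR_ge0.
have q1 : 0 < q + 1 by rewrite ltr_wpDl.
(* The error in the exponent is taken as [e / (q + 1)]: by [expR (- x) >= 1 - x] it costs at most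
   [q * (e / (q + 1)) <= e]. *)
have := main _ (divr_gt0 e0 q1).
rewrite opprD expRD mulrAC -/q.
have := expR_ge1Dx (- (e / (q + 1))).
move=> h1 h2.
have : q * (1 - e / (q + 1)) <= u T.
  by apply: le_trans h2; rewrite ler_wpM2l.
have h3 : q * (e / (q + 1)) <= e.
  by rewrite mulrA ler_pdivrMr// mulrC ler_pM2l//; lra.
by rewrite mulrBr; lra.
Unshelve. all: by end_near.
Qed.

End Gronwall.

(** * Probability kernels as operators on bounded functions *)

Section ProbabilityKernels.

Section ProbabilityOfMeasure.
Context d (T : measurableType d) (R : realType).
Variables (m : {measure set T -> \bar R}) (m1 : m setT = 1%E).

(** An alias of [m] that carries the proof of total mass one, so that a probability structure can be
    attached to it. *)
Definition normalized_measure of m setT = 1%E : set T -> \bar R := m.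
Local Notation pm := (normalized_measure m1).
Let pm0 : pm set0 = 0%E. Proof. exact: measure0. Qed.
Let pm_ge0 A : (0 <= pm A)%E. Proof. exact: measure_ge0. Qed.
Let pm_sigma : semi_sigma_additive pm.
Proof. exact: measure_semi_sigma_additive. Qed.

HB.instance Definition _ := isMeasure.Build _ _ _ pm pm0 pm_ge0 pm_sigma.
HB.instance Definition _ := Measure_isProbability.Build _ _ _ pm m1.

Lemma probability_of_measure :
  exists p : probability T R, (p : {measure set T -> \bar R}) = m.
Proof. by exists pm; exact: eq_measure. Qed.

End ProbabilityOfMeasure.

Context d d' (T : measurableType d) (U : measurableType d') (R : realType).
Variable Q : R.-pker T ~> U.

Definition kernel_op (g : U -> R) (x : T) : R := \int[Q x]_y g y.

Lemma kernel_probability x :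
  exists p : probability U R, (p : {measure set U -> \bar R}) = Q x.
Proof. by apply: probability_of_measure; exact: prob_kernel. Qed.

Lemma kernel_op_lin (a : R) g h x : bounded_measurable g -> bounded_measurable h ->
  kernel_op (fun y => a * g y + h y) x = a * kernel_op g x + kernel_op h x.
Proof.
rewrite /kernel_op; have [p <-] := kernel_probability x => bg bh.
by rewrite bRintegralD ?bRintegralZ//; exact: bounded_measurableZ.
Qed.

Lemma kernel_op_close g h e x : bounded_measurable g -> bounded_measurable h ->
  (forall y, `|g y - h y| <= e) -> `|kernel_op g x - kernel_op h x| <= e.
Proof.
by rewrite /kernel_op; have [p <-] := kernel_probability x; exact: bRintegral_close.
Qed.

Lemma kernel_op_ge0 g x : (forall y, 0 <= g y) -> 0 <= kernel_op g x.
Proof. by move=> g0; apply: Rintegral_ge0. Qed.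

Lemma kernel_op_cst (c : R) x : kernel_op (fun=> c) x = c.
Proof.
by rewrite /kernel_op; have [p <-] := kernel_probability x; exact: bRintegral_cst.
Qed.

Lemma kernel_op_indic A x : measurable A -> kernel_op \1_A x = fine (Q x A).
Proof.
by rewrite /kernel_op; have [p <-] := kernel_probability x; exact: bRintegral_indic.
Qed.

Lemma bounded_measurable_kernel_op g : bounded_measurable g ->
  bounded_measurable (kernel_op g).
Proof.
move=> bg; have [mg [b gb]] := bg; split; last first.
  exists b => x; have := @kernel_op_close g (fun=> 0) b x bg.
  rewrite kernel_op_cst subr0; apply; first exact: bounded_measurable_cst.
  by move=> y; rewrite subr0.
(* Measurability of the integral in the parameter is invoked for a nonnegative integrand; since
   [Q x] has mass one, the shift by [b] is undone by subtracting [b]. *)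
have bgb : bounded_measurable (fun y => g y + b).
  by apply: bounded_measurableD => //; exact: bounded_measurable_cst.
rewrite (_ : kernel_op g = fun x => fine (\int[Q x]_y (g y + b)%:E)%E - b); last first.
  apply/funext => x; have [p pE] := kernel_probability x.
  rewrite /kernel_op -pE -[fine _]/(\int[p]_y (g y + b)).
  by rewrite bRintegralD ?bRintegral_cst ?addrK//; exact: bounded_measurable_cst.
apply: measurable_funB => //; apply: measurableT_comp => //.
apply: measurable_fun_integral_kernel => //.
- by move=> V mV; exact: measurable_kernel.
- by move=> y; rewrite lee_fin; have := gb y; rewrite ler_norml => /andP[]; lra.
- by apply/measurable_EFinP; case: bgb.
Qed.

End ProbabilityKernels.

(** * Functionals determined by their values on indicators *)

Section BoundedFunctionals.
Context d (T : measurableType d) (R : realType).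

(** Continuous linear forms for the sup norm, with the norm hidden in the pairwise closeness
    condition. *)
Definition bounded_functional (L : (T -> R) -> R) : Prop :=
  (forall (a : R) g h, bounded_measurable g -> bounded_measurable h ->
    L (fun x => a * g x + h x) = a * L g + L h) /\
  exists2 K : R, 0 <= K & forall (e : R) g h,
    bounded_measurable g -> bounded_measurable h ->
    (forall x, `|g x - h x| <= e) -> `|L g - L h| <= K * e.

Lemma eq_bounded_functional (L1 L2 : (T -> R) -> R) :
  bounded_functional L1 -> bounded_functional L2 ->
  (forall A, measurable A -> L1 \1_A = L2 \1_A) ->
  forall g, bounded_measurable g -> L1 g = L2 g.
Proof.
move=> [lin1 [K1 K10 close1]] [lin2 [K2 K20 close2]] LA.
apply: bounded_measurable_ind => [//|a g h bg bh E1 E2|g bg H].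
  by rewrite lin1// lin2// E1 E2.
apply/eqP; rewrite -subr_eq0 -normr_le0; apply/ler_addgt0Pr => e e0.
(* The [+ 1] keeps the divisor positive when both functionals have constant 0. *)
have K0 : 0 < K1 + K2 + 1 by lra.
have [h [bh E gh]] := H _ (divr_gt0 e0 K0).
have := close1 _ _ _ bg bh gh; have := close2 _ _ _ bg bh gh.
set c := e / _ => h2 h1; rewrite add0r.
have -> : L1 g - L2 g = (L1 g - L1 h) - (L2 g - L2 h) by rewrite E; ring.
rewrite (le_trans (ler_normB _ _))// (le_trans (lerD h1 h2))// -mulrDl.
by rewrite /c mulrA ler_pdivrMr// mulrC ler_wpM2l// ?ltW//; lra.
Qed.

Lemma bounded_functional_Rintegral d' (Omega : measurableType d')
    (P : probability Omega R) (k : Omega -> R) (A : (T -> R) -> Omega -> R) :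
  bounded_measurable k ->
  (forall g, bounded_measurable g -> bounded_measurable (A g)) ->
  (forall (a : R) g h w, bounded_measurable g -> bounded_measurable h ->
    A (fun x => a * g x + h x) w = a * A g w + A h w) ->
  (forall (e : R) g h w, bounded_measurable g -> bounded_measurable h ->
    (forall x, `|g x - h x| <= e) -> `|A g w - A h w| <= e) ->
  bounded_functional (fun g => \int[P]_w (k w * A g w)).
Proof.
move=> bk bA linA closeA; split=> [a g h bg bh|].
  rewrite -bRintegralZ; last exact/bounded_measurableM/bA.
  rewrite -bRintegralD; last 2 first.
  - exact/bounded_measurableZ/bounded_measurableM/bA.
  - exact/bounded_measurableM/bA.
  by apply: eq_Rintegral => w _; rewrite linA// mulrDr; ring.
have [_ [b kb]] := bk; exists `|b| => // e g h bg bh gh.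
apply: bRintegral_close => [||w]; [exact/bounded_measurableM/bA..|].
rewrite -mulrBr normrM ler_pM//; first exact: le_trans (kb w) (ler_norm _).
exact: closeA.
Qed.

End BoundedFunctionals.

(** * Integrated forms of the kernel and Markov properties *)

Section DenoisingProcess.
Context d (Omega : measurableType d) (R : realType) (n : nat).
Variables (P : probability Omega R) (X : R -> {RV P >-> rn R n}).
Variable Q : R -> R -> R.-pker rn R n ~> rn R n.
Implicit Types (k g f : rn R n -> R).
Local Notation Y := (denoising X).

Lemma bounded_measurable_RV k (Z : {RV P >-> rn R n}) : bounded_measurable k ->
  bounded_measurable (fun w => k (Z w)).
Proof. by apply: bounded_measurable_comp; exact: measurable_funPT. Qed.

Lemma Rintegral_denoising_law k eta : bounded_measurable k ->
  \int[denoising_law X eta]_x k x = \int[P]_w k (Y eta w).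
Proof.
move=> bk; rewrite /Rintegral /denoising_law integral_distribution//.
  by apply/measurable_EFinP; case: bk.
by apply: bounded_measurable_integrable => //; exact: bounded_measurable_RV.
Qed.

Lemma bounded_functional_RV (c : Omega -> R) (Z : {RV P >-> rn R n}) :
  bounded_measurable c ->
  bounded_functional (fun g => \int[P]_w (c w * g (Z w))).
Proof.
move=> bc; apply: (@bounded_functional_Rintegral _ _ _ _ _ P c
  (fun g w => g (Z w))) => //.
by move=> g bg; exact: bounded_measurable_RV.
Qed.

Lemma Rintegral_indicM2 (Z1 Z2 : {RV P >-> rn R n}) A B : measurable A ->
  measurable B ->
  \int[P]_w (\1_A (Z1 w) * \1_B (Z2 w)) = fine (P (Z1 @^-1` A `&` Z2 @^-1` B)).
Proof.
move=> mA mB; rewrite -bRintegral_indic; last first.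
  apply: measurableI; rewrite -[X in measurable X]setTI.
    exact: (measurable_funPT Z1).
  exact: (measurable_funPT Z2).
by apply: eq_Rintegral => w _; rewrite indicI.
Qed.

(** The kernel hypothesis is the case of two indicators. Both sides are bounded functionals of [g]
    for fixed [k], and of [k] once [g] is an indicator, so the extension is made one variable at a
    time. *)
Lemma Rintegral_kernel (kerQ : denoising_kernel X Q) eta theta k g :
  0 <= eta -> eta <= theta -> theta <= 1 ->
  bounded_measurable k -> bounded_measurable g ->
  \int[P]_w (k (Y eta w) * g (Y theta w)) =
  \int[P]_w (k (Y eta w) * kernel_op (Q eta theta) g (Y eta w)).
Proof.
move=> eta0 et t1 bk.
apply: (@eq_bounded_functional _ _ _
  (fun g => \int[P]_w (k (Y eta w) * g (Y theta w)))
  (fun g => \int[P]_w (k (Y eta w) * kernel_op (Q eta theta) g (Y eta w)))).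
- exact/bounded_functional_RV/bounded_measurable_RV.
- apply: (@bounded_functional_Rintegral _ _ _ _ _ P _
    (fun g w => kernel_op (Q eta theta) g (Y eta w))).
  + exact: bounded_measurable_RV.
  + by move=> h bh; exact/bounded_measurable_RV/bounded_measurable_kernel_op.
  + by move=> *; exact: kernel_op_lin.
  + by move=> *; exact: kernel_op_close.
move=> B mB; have bB := bounded_measurable_indic R mB.
under eq_Rintegral do rewrite mulrC.
under [RHS]eq_Rintegral do rewrite mulrC.
move: k bk; apply: (@eq_bounded_functional _ _ _
  (fun k => \int[P]_w (\1_B (Y theta w) * k (Y eta w)))
  (fun k => \int[P]_w (kernel_op (Q eta theta) \1_B (Y eta w) * k (Y eta w)))).
- exact/bounded_functional_RV/bounded_measurable_RV.
- exact/bounded_functional_RV/bounded_measurable_RV/bounded_measurable_kernel_op.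
move=> A mA.
under eq_Rintegral do rewrite mulrC.
rewrite Rintegral_indicM2// kerQ//.
have bA := bounded_measurable_indic R mA.
have bQ : bounded_measurable (fun x => kernel_op (Q eta theta) \1_B x * \1_A x).
  by apply: bounded_measurableM => //; exact: bounded_measurable_kernel_op.
rewrite -(Rintegral_denoising_law _ bQ) /Rintegral [in LHS]integral_mkcond.
congr fine; apply: eq_integral => x _; rewrite patchE indicE kernel_op_indic//.
case: ifPn => _; rewrite ?mulr1 ?mulr0// fineK//.
by have [p <-] := kernel_probability (Q eta theta) x; exact: fin_num_measure.
Qed.

(** The same [g] serves all earlier times [u]. The tower property relies on this, using it at
    [u = 0] and at [u = s]. *)
Lemma Rintegral_markov (markovX : Defs.markov X) s t B :
  0 <= s -> s <= t -> t <= 1 -> measurable B ->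
  exists2 g : rn R n -> R, bounded_measurable g &
    forall u F, 0 <= u -> u <= s -> bounded_measurable F ->
      \int[P]_w (F (X u w) * \1_B (X t w)) = \int[P]_w (F (X u w) * g (X s w)).
Proof.
move=> s0 st t1 mB; have [g [mg g01 gE]] := markovX s t s0 st t1 B mB.
have bg : bounded_measurable g.
  split=> //; exists 1 => x; have /andP[g0 g1] := g01 x.
  by rewrite ger0_norm.
exists g => // u F u0 us.
under eq_Rintegral do rewrite mulrC.
under [X in _ -> _ = X]eq_Rintegral do rewrite mulrC.
move: F; apply: (@eq_bounded_functional _ _ _
  (fun F => \int[P]_w (\1_B (X t w) * F (X u w)))
  (fun F => \int[P]_w (g (X s w) * F (X u w)))).
- exact/bounded_functional_RV/bounded_measurable_RV/bounded_measurable_indic.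
- exact/bounded_functional_RV/bounded_measurable_RV.
move=> A mA.
under eq_Rintegral do rewrite mulrC.
rewrite Rintegral_indicM2// gE; last first.
  apply: sub_sigma_algebra; exists u; first by rewrite /= in_itv/= u0.
  by exists A => //; rewrite setTI.
rewrite /Rintegral [in LHS]integral_mkcond; congr fine; apply: eq_integral => w _.
rewrite patchE indicE (_ : (X u w \in A) = (w \in X u @^-1` A)); last first.
  by apply/idP/idP; rewrite !inE.
by case: ifPn => _; rewrite ?mulr1 ?mulr0.
Qed.

(** The Markov property survives time reversal. With [k] an indicator, the event at [eta] lies in
    the future of [X] at time [1 - theta]; its conditional probability given the past of [X] is some
    [g (Y theta)], against which both integrands agree by the definition of [Q theta 1]. *)
Lemma Rintegral_tower (markovX : Defs.markov X) (kerQ : denoising_kernel X Q)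
    eta theta k f :
  0 <= eta -> eta <= theta -> theta <= 1 ->
  bounded_measurable k -> bounded_measurable f ->
  \int[P]_w (k (Y eta w) * f (Y 1 w)) =
  \int[P]_w (k (Y eta w) * kernel_op (Q theta 1) f (Y theta w)).
Proof.
move=> eta0 et t1 bk bf.
have theta0 := le_trans eta0 et.
have bQ := bounded_measurable_kernel_op (Q theta 1) bf.
under eq_Rintegral do rewrite mulrC.
under [RHS]eq_Rintegral do rewrite mulrC.
move: k bk; apply: (@eq_bounded_functional _ _ _
  (fun k => \int[P]_w (f (Y 1 w) * k (Y eta w)))
  (fun k => \int[P]_w (kernel_op (Q theta 1) f (Y theta w) * k (Y eta w)))).
- exact/bounded_functional_RV/bounded_measurable_RV.
- exact/bounded_functional_RV/bounded_measurable_RV.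
move=> B mB.
have [|||g bg gE] := @Rintegral_markov markovX (1 - theta) (1 - eta) B _ _ _ mB.
- by rewrite subr_ge0.
- by rewrite lerD2l lerN2.
- by rewrite gerBl.
rewrite /denoising gE ?subrr ?subr_ge0// gE ?subr_ge0//.
under eq_Rintegral do rewrite mulrC.
under [RHS]eq_Rintegral do rewrite mulrC.
have := @Rintegral_kernel kerQ theta 1 g f theta0 t1 (lexx _) bg bf.
by rewrite /denoising subrr.
Qed.

End DenoisingProcess.

(** * Left continuity of the denoised values in L^2 *)

Section LeftContinuity.
Context d (Omega : measurableType d) (R : realType) (n : nat).
Variables (P : probability Omega R) (X : R -> {RV P >-> rn R n}).
Variable Q : R -> R -> R.-pker rn R n ~> rn R n.
Implicit Types (g h f : rn R n -> R).
Local Notation Y := (denoising X).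

Lemma measurable_coord i j :
  measurable_fun setT (fun x : rn R n => (x : 'rV[R]_n) i j).
Proof.
apply: (measurability _ (RGenOpens.measurableE R)) => _ [_ [a [b ->] <-]].
rewrite setTI; apply: sub_sigma_algebra.
by apply: open_comp; [move=> x _; exact: coord_continuous | exact: interval_open].
Qed.

Lemma measurable_coord_RV (Z : {RV P >-> rn R n}) i j :
  measurable_fun setT (fun o => (Z o : 'rV[R]_n) i j).
Proof. exact: (measurableT_comp (measurable_coord i j) (measurable_funPT Z)). Qed.

(** The norm is the sup norm, so the complement is a finite intersection of conditions on real
    coordinates. With [0 < e] this holds even for [n = 0], where the intersection is everything. *)
Lemma measurable_dist_ge (Z1 Z2 : {RV P >-> rn R n}) (e : R) : 0 < e ->
  measurable [set w | e <= `|(Z1 w : 'rV[R]_n) - Z2 w|].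
Proof.
move=> e0.
pose near_coord (j : 'I_n) := [set w |
  `|(Z1 w : 'rV[R]_n) ord0 j - (Z2 w : 'rV[R]_n) ord0 j| < e].
rewrite (_ : [set w | _] = ~` \bigcap_(j in [set: 'I_n]) near_coord j).
  apply/measurableC/fin_bigcap_measurable => // j _.
  rewrite -[X in measurable X]setTI.
  apply: (measurable_fun_ltr (f := fun w =>
      `|(Z1 w : 'rV[R]_n) ord0 j - (Z2 w : 'rV[R]_n) ord0 j|)) => //.
  apply: measurableT_comp => //.
  by apply: measurable_funB; exact: measurable_coord_RV.
have distE w : (`|(Z1 w : 'rV[R]_n) - Z2 w| < e) <->
    (\bigcap_(j in [set: 'I_n]) near_coord j) w.
  split=> [|H].
    have <- : ball (Z1 w : 'rV[R]_n) e (Z2 w) =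
        (`|(Z1 w : 'rV[R]_n) - Z2 w| < e).
      by rewrite -ball_normE.
    by move=> [_ /(_ ord0)] H j _; have := H j; rewrite -ball_normE.
  have -> : (`|(Z1 w : 'rV[R]_n) - Z2 w| < e) =
      ball (Z1 w : 'rV[R]_n) e (Z2 w) :> Prop.
    by rewrite -ball_normE.
  by split=> // i j; rewrite -ball_normE/= ord1; exact: H.
apply/seteqP; split=> w /=.
  by move=> ge /distE; rewrite ltNge ge.
by move=> H; rewrite leNgt; apply/negP => /distE.
Qed.

(* [h (Y eta)] is an L^2 limit of functions of [Y theta] as [theta] increases
   to [eta]. *)
Definition left_approximable (eta : R) h : Prop := forall e : R, 0 < e ->
  \forall theta \near eta^'-, exists2 w, bounded_measurable w &
    \int[P]_o (h (Y eta o) - w (Y theta o)) ^+ 2 <= e.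

Let bounded_measurable_diff2 h w s t : bounded_measurable h ->
  bounded_measurable w ->
  bounded_measurable (fun o => (h (Y s o) - w (Y t o)) ^+ 2).
Proof.
move=> bh bw; apply: bounded_measurableX2.
by apply: bounded_measurableB; exact: bounded_measurable_RV.
Qed.

Lemma left_approximable_closed eta g : bounded_measurable g ->
  (forall e : R, 0 < e -> exists h,
    [/\ bounded_measurable h, left_approximable eta h &
    \int[P]_o (g (Y eta o) - h (Y eta o)) ^+ 2 <= e]) ->
  left_approximable eta g.
Proof.
(* The quarters come from (x + y)^2 <= 2 x^2 + 2 y^2. *)
move=> bg H e e0; have e4 : 0 < e / 4 by rewrite divr_gt0.
have [h [bh ah gh]] := H _ e4.
have := ah _ e4; apply: filterS => theta [w bw hw]; exists w => //.
have le2 : forall o, (g (Y eta o) - w (Y theta o)) ^+ 2 <=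
    2 * (g (Y eta o) - h (Y eta o)) ^+ 2 + 2 * (h (Y eta o) - w (Y theta o)) ^+ 2.
  move=> o; have := sqr_ge0 ((g (Y eta o) - h (Y eta o)) -
    (h (Y eta o) - w (Y theta o))).
  by rewrite !expr2; lra.
have b1 := bounded_measurable_diff2 eta eta bg bh.
have b2 := bounded_measurable_diff2 eta theta bh bw.
rewrite (le_trans (ble_Rintegral P _ _ le2))//.
- exact: bounded_measurable_diff2.
- by apply: bounded_measurableD; exact: bounded_measurableZ.
- rewrite bRintegralD ?bRintegralZ//; [lra|exact: bounded_measurableZ..].
Qed.

Lemma left_approximable_lin eta (a : R) g h : bounded_measurable g ->
  bounded_measurable h -> left_approximable eta g -> left_approximable eta h ->
  left_approximable eta (fun x => a * g x + h x).
Proof.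
move=> bg bh ag ah e e0.
have a0 : 0 < a ^+ 2 + 1 by rewrite ltr_wpDl// sqr_ge0.
have e4 : 0 < e / 4 by rewrite divr_gt0.
have ea : 0 < (e / 4) / (a ^+ 2 + 1) by rewrite divr_gt0.
have := ag _ ea; have := ah _ e4.
apply: filterS2 => theta [w2 bw2 hw2] [w1 bw1 gw1].
exists (fun x => a * w1 x + w2 x).
  by apply: bounded_measurableD => //; exact: bounded_measurableZ.
have le2 : forall o,
    (a * g (Y eta o) + h (Y eta o) - (a * w1 (Y theta o) + w2 (Y theta o))) ^+ 2 <=
    2 * a ^+ 2 * (g (Y eta o) - w1 (Y theta o)) ^+ 2 +
    2 * (h (Y eta o) - w2 (Y theta o)) ^+ 2.
  move=> o; have := sqr_ge0 (a * (g (Y eta o) - w1 (Y theta o)) -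
    (h (Y eta o) - w2 (Y theta o))).
  by rewrite !expr2; lra.
have b1 := bounded_measurable_diff2 eta theta bg bw1.
have b2 := bounded_measurable_diff2 eta theta bh bw2.
have bag : bounded_measurable (fun x => a * g x + h x).
  by apply: bounded_measurableD => //; exact: bounded_measurableZ.
have baw : bounded_measurable (fun x => a * w1 x + w2 x).
  by apply: bounded_measurableD => //; exact: bounded_measurableZ.
rewrite (le_trans (ble_Rintegral P _ _ le2))//.
- exact: (bounded_measurable_diff2 eta theta bag baw).
- by apply: bounded_measurableD; exact: bounded_measurableZ.
- rewrite bRintegralD ?bRintegralZ//; [|exact: bounded_measurableZ..].
  set I1 := \int[P]_x (g _ - _) ^+ 2 in gw1 *.
  have : a ^+ 2 * I1 <= e / 4.
    have I10 : 0 <= I1 by apply: Rintegral_ge0 => o _; exact: sqr_ge0.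
    move: gw1; rewrite ler_pdivlMr//; lra.
  lra.
Qed.

(** For nested sets the squared L^2 distance of the indicators is the difference of the measures,
    which tends to 0 by continuity from below. *)
Lemma left_approximable_indic_ndseq eta (F : (set (rn R n))^nat) :
  (forall i, measurable (F i)) -> nondecreasing_seq F ->
  (forall i, left_approximable eta \1_(F i)) ->
  left_approximable eta \1_(\bigcup_i F i).
Proof.
move=> mF ndF aF.
have mU : measurable (\bigcup_i F i) by exact: bigcupT_measurable.
have bU := bounded_measurable_indic R mU.
apply: left_approximable_closed => // e e0.
pose nu : probability (rn R n) R := denoising_law X eta.
have cvnu : nu (F i) @[i --> \oo] --> nu (\bigcup_i F i).
  exact: nondecreasing_cvg_mu.
have {cvnu} : fine (nu (F i)) @[i --> \oo] --> fine (nu (\bigcup_i F i)).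
  by apply: fine_cvg; rewrite fineK//; exact: fin_num_measure.
move=> /cvgrPdist_le/(_ _ e0)[i _ /(_ i (leqnn i))/= Fi].
have bF := bounded_measurable_indic R (mF i).
exists \1_(F i); split => //.
have subF : F i `<=` \bigcup_j F j by move=> x Fx; exists i.
rewrite (_ : \int[P]_o _ = \int[nu]_x (\1_(\bigcup_i F i) x - \1_(F i) x)).
  rewrite bRintegralB// !bRintegral_indic//.
  by rewrite (le_trans (ler_norm _)).
rewrite Rintegral_denoising_law; last exact: bounded_measurableB.
apply: eq_Rintegral => o _; rewrite !indicE.
have [Fx|nFx] := boolP (Y eta o \in F i).
  rewrite mem_set ?subrr ?expr0n//; by apply: subF; rewrite inE in Fx.
by case: (_ \in _); rewrite subr0 ?expr1n ?expr0n.
Qed.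

(** [A r] collects the points at distance at least [r] from the complement of [U], and exhausts [U]
    as [r] decreases to 0. The indicator of [U] at [Y eta] is approximated by that of the smaller
    set [A (r / 2)] at [Y theta], the margin leaving room for a displacement of [r / 2]. *)
Lemma left_approximable_indic_open
    (regX : right_continuous_in_probability X) eta (U : set 'rV[R]_n) :
  0 < eta -> eta <= 1 -> open U ->
  left_approximable eta (\1_(U : set (rn R n))).
Proof.
move=> eta0 eta1 oU e e0.
pose A (r : R) : set 'rV[R]_n := [set x | forall y, ~ U y -> r <= `|y - x|].
have mA r : measurable (A r : set (rn R n)).
  have [r0|r0] := ltP 0 r; last first.
    rewrite (_ : A r = setT); first exact: measurableT.
    by apply/seteqP; split=> // x _ y _; exact: le_trans r0 _.
  rewrite (_ : A r = ~` \bigcup_(y in ~` U) ball y r).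
    apply: measurableC; apply: sub_sigma_algebra.
    by apply: bigcup_open => y _; exact: ball_open.
  apply/seteqP; split=> x /= H.
    by move=> [y Uy]; rewrite -ball_normE/= ltNge H.
  move=> y Uy; rewrite leNgt; apply/negP => yx; apply: H.
  by exists y => //; rewrite -ball_normE.
have mU : measurable (U : set (rn R n)) by exact: sub_sigma_algebra.
have AU r : 0 < r -> A r `<=` U.
  move=> r0 x Ax; apply: contrapT => /Ax; rewrite subrr normr0 leNgt.
  by rewrite r0.
pose F (i : nat) : set (rn R n) := A (i.+1%:R^-1).
have UF : \bigcup_i F i = U.
  apply/seteqP; split=> [x [i _]|x Ux]; first by apply: AU; rewrite invr_gt0.
  have /nbhs_ballP[r /= r0 rU] : nbhs (x : 'rV[R]_n) U by exact: open_nbhs_nbhs.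
  exists (Num.truncn r^-1) => // y Uy.
  rewrite (@le_trans _ _ r)//.
    rewrite -[leRHS]invrK lef_pV2 ?posrE ?invr_gt0//.
    by rewrite ltW// truncnS_gt.
  rewrite leNgt; apply/negP => yx; apply: Uy; apply: rU.
  by rewrite -ball_normE/= distrC.
pose nu : probability (rn R n) R := denoising_law X eta.
have cvnu : nu (F i) @[i --> \oo] --> nu (U : set (rn R n)).
  rewrite -[in X in _ --> X]UF; apply: nondecreasing_cvg_mu.
  - by move=> i; exact: mA.
  - by rewrite UF.
  - move=> i j ij; apply/subsetPset => x Fx y Uy.
    by apply: le_trans (Fx y Uy); rewrite lef_pV2 ?posrE// ler_nat ltnS.
have e20 : 0 < e / 2 by rewrite divr_gt0.
have {cvnu} : fine (nu (F i)) @[i --> \oo] --> fine (nu (U : set (rn R n))).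
  by apply: fine_cvg; rewrite fineK//; exact: fin_num_measure.
move=> /cvgrPdist_le/(_ _ e20)[i _ /(_ i (leqnn i))/= Fi].
pose r : R := i.+1%:R^-1.
have r0 : 0 < r by rewrite invr_gt0.
have r20 : 0 < r / 2 by rewrite divr_gt0.
(* Continuity in probability of [X] from the right at [1 - eta], that is, of Y from the left at
   [eta]. *)
have [q q0 Hq] : exists2 q, 0 < q & forall s, 1 - eta < s -> s < 1 - eta + q ->
    fine (P [set w | r / 2 <= `|(X s w : 'rV[R]_n) - X (1 - eta) w|]) <= e / 2.
  apply: near_at_rightP.
  have t0 : 0 <= 1 - eta by rewrite subr_ge0.
  have t1 : 1 - eta < 1 by rewrite ltrBlDr ltrDl.
  have /fine_cvg/cvgrPdist_le/(_ _ e20) := regX _ _ t0 t1 r20.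
  by apply: filterS => s /=; rewrite sub0r normrN; exact: le_trans (ler_norm _).
near=> theta.
have thetaeta : theta < eta by near: theta; exact: nbhs_left_lt.
have thetaq : eta - q < theta.
  by near: theta; apply: nbhs_left_gt; rewrite ltrBlDr ltrDl.
exists (\1_(A (r / 2) : set (rn R n))); first exact: bounded_measurable_indic.
have {Hq} := Hq (1 - theta) _ _; rewrite -/(Y theta) -/(Y eta).
set far := [set w | _] => Hq.
have mfar : measurable far by exact: measurable_dist_ge.
(* When the two positions are closer than [r / 2], [Y eta] in [A r] forces [Y theta] in [A (r / 2)],
   which forces [Y eta] in [U]. An error therefore needs [Y eta] in [U] but outside [A r], or a
   large displacement. *)
have sub o :
    (\1_(U : set (rn R n)) (Y eta o) -
     \1_(A (r / 2) : set (rn R n)) (Y theta o)) ^+ 2 <=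
    (\1_(U : set (rn R n)) (Y eta o) - \1_(A r : set (rn R n)) (Y eta o)) +
    \1_far o :> R.
  rewrite !indicE; have [ofar|nfar] := boolP (o \in far).
    have : (Y eta o \in A r) -> (Y eta o \in U).
      by rewrite !inE; exact: AU.
    case: (Y eta o \in A r); case: (Y eta o \in U);
      case: (Y theta o \in A (r / 2)) => // H; rewrite /= ?expr2;
      try (by have := H isT); lra.
  have {nfar}close : `|(Y theta o : 'rV[R]_n) - Y eta o| < r / 2.
    by rewrite ltNge; apply: contra nfar => h; rewrite inE.
  have h1 : (Y theta o \in A (r / 2)) -> (Y eta o \in U).
    rewrite !inE => Ar; apply: contrapT => /Ar; rewrite distrC leNgt.
    by rewrite close.
  have h2 : (Y eta o \in A r) -> (Y theta o \in A (r / 2)).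
    rewrite !inE => Ar y Uy; have := Ar y Uy.
    have := ler_normD (y - (Y theta o : 'rV[R]_n))
      ((Y theta o : 'rV[R]_n) - Y eta o).
    by rewrite addrA subrK; lra.
  move: h1 h2; case: (Y eta o \in A r); case: (Y eta o \in U);
    case: (Y theta o \in A (r / 2)) => // h1 h2; rewrite /= ?expr2;
    try (by have := h1 isT); try (by have := h2 isT); lra.
have bU := bounded_measurable_indic R mU.
have bA s := bounded_measurable_indic R (mA s).
have bfar := bounded_measurable_indic R mfar.
have bUA : bounded_measurable (fun o =>
    \1_(U : set (rn R n)) (Y eta o) - \1_(A r : set (rn R n)) (Y eta o) : R).
  by apply: bounded_measurableB; exact: bounded_measurable_RV.
rewrite (le_trans (ble_Rintegral P _ _ sub))//.
- exact: bounded_measurable_diff2.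
- exact: bounded_measurableD.
rewrite bRintegralD// bRintegral_indic//.
rewrite -(Rintegral_denoising_law X eta (bounded_measurableB bU (bA r))).
rewrite bRintegralB// !bRintegral_indic//.
have := le_trans (ler_norm _) Fi; rewrite -/nu -/(F i) => h1.
have : fine (P far) <= e / 2 by apply: Hq; lra.
by move: h1; rewrite /F -/r; lra.
Unshelve. all: by end_near.
Qed.

Lemma left_approximable_bounded_measurable
    (regX : right_continuous_in_probability X) eta h :
  0 < eta -> eta <= 1 -> bounded_measurable h -> left_approximable eta h.
Proof.
move=> eta0 eta1; move: h.
have approx_cst (c : R) : left_approximable eta (fun=> c).
  move=> e e0; apply: nearW => theta; exists (fun=> c).
    exact: bounded_measurable_cst.
  by under eq_Rintegral do rewrite subrr expr0n/=; rewrite bRintegral_cst ltW.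
apply: bounded_measurable_ind => [B mB|a g h bg bh|g bg H].
- suff : <<s @open 'rV[R]_n >> `<=`
      [set B | measurable (B : set (rn R n)) /\
        left_approximable eta (\1_(B : set (rn R n)))].
    by move=> /(_ B mB)[].
  (* Dynkin's theorem: the open sets are stable under intersection and generate the Borel sets, and
     the approximable sets form a lambda-system. *)
  apply: lambda_system_subset => //; first exact: openI.
    split=> //.
    + split; first exact: measurableT.
      by rewrite indicT; exact: approx_cst.
    + move=> B1 B2 B21 [m1 a1] [m2 a2]; split; first exact: measurableD.
      rewrite (_ : \1_(B1 `\` B2) =
        (fun x : rn R n => -1 * \1_(B2 : set (rn R n)) x +
          \1_(B1 : set (rn R n)) x)).
        by apply: left_approximable_lin => //; exact: bounded_measurable_indic.
      apply/funext => x; rewrite !indicE in_setD.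
      have : (x \in B2) -> (x \in B1) by rewrite !inE; exact: B21.
      by case: (x \in B1); case: (x \in B2) => H;
        rewrite /=; try (by have := H isT); ring.
    + move=> F ndF HF; split.
        by apply: bigcupT_measurable => i; case: (HF i).
      by apply: left_approximable_indic_ndseq => // i; case: (HF i).
  move=> U oU; split; first exact: sub_sigma_algebra.
  exact: left_approximable_indic_open.
- exact: left_approximable_lin.
- apply: left_approximable_closed => // e e0.
  (* A uniform error at most [min 1 e] has a square at most [e]. *)
  pose q := Num.min 1 e.
  have q0 : 0 < q by rewrite lt_min ltr01.
  have [w [bw aw gw]] := H _ q0; exists w; split => //.
  rewrite -[leRHS](bRintegral_cst P); apply: ble_Rintegral.
  + exact: bounded_measurable_diff2.
  + exact: bounded_measurable_cst.
  + move=> o; rewrite -real_normK ?num_real//.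
    have q1 : q <= 1 by rewrite /q ge_min lexx.
    have qe : q <= e by rewrite /q ge_min lexx orbT.
    have := gw (Y eta o); have := normr_ge0 (g (Y eta o) - w (Y eta o)).
    by rewrite expr2; nra.
Qed.

(* [kernel_op (Q theta 1) f (Y theta)] is the orthogonal projection of [f (Y 1)]
   on the functions of [Y theta]. *)
Lemma denoised_projection (markovX : Defs.markov X) (kerQ : denoising_kernel X Q)
    eta theta f w : 0 <= theta -> theta <= eta -> eta <= 1 ->
  bounded_measurable f -> bounded_measurable w ->
  \int[P]_o (kernel_op (Q eta 1) f (Y eta o) -
             kernel_op (Q theta 1) f (Y theta o)) ^+ 2 <=
  \int[P]_o (kernel_op (Q eta 1) f (Y eta o) - w (Y theta o)) ^+ 2.
Proof.
move=> theta0 te eta1 bf bw.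
set a := kernel_op (Q eta 1) f; set b := kernel_op (Q theta 1) f.
have ba : bounded_measurable a by exact: bounded_measurable_kernel_op.
have bb : bounded_measurable b by exact: bounded_measurable_kernel_op.
have bk : bounded_measurable (fun x => b x - w x) by exact: bounded_measurableB.
have bkY := bounded_measurable_RV (Y theta) bk.
have baY := bounded_measurable_RV (Y eta) ba.
have bbY := bounded_measurable_RV (Y theta) bb.
(* Orthogonality: against a function of [Y theta], both [a (Y eta)] and [b (Y theta)] integrate like
   [f (Y 1)], by the tower property at [eta] and at [theta]. *)
have cross : \int[P]_o ((b (Y theta o) - w (Y theta o)) *
    (a (Y eta o) - b (Y theta o))) = 0.
  under eq_Rintegral do rewrite mulrBr.
  rewrite bRintegralB; [|exact: bounded_measurableM..].
  have := Rintegral_tower markovX kerQ theta0 te eta1 bk bf.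
  have := Rintegral_tower markovX kerQ theta0 (lexx _) (le_trans te eta1) bk bf.
  by rewrite /= -/a -/b => <- <-; rewrite subrr.
have b1 := bounded_measurable_diff2 eta theta ba bb.
have b2 := bounded_measurableX2 bkY.
have b3 : bounded_measurable (fun o => (b (Y theta o) - w (Y theta o)) *
    (a (Y eta o) - b (Y theta o))).
  by apply: bounded_measurableM => //; exact: bounded_measurableB.
have -> : \int[P]_o (a (Y eta o) - w (Y theta o)) ^+ 2 =
    \int[P]_o ((a (Y eta o) - b (Y theta o)) ^+ 2 +
      ((b (Y theta o) - w (Y theta o)) ^+ 2 +
       2 * ((b (Y theta o) - w (Y theta o)) * (a (Y eta o) - b (Y theta o))))).
  by apply: eq_Rintegral => o _; ring.
have b4 := bounded_measurableZ 2 b3.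
rewrite bRintegralD//; last exact: bounded_measurableD.
rewrite bRintegralD// bRintegralZ// cross mulr0 addr0 lerDl.
by apply: Rintegral_ge0 => o _; exact: sqr_ge0.
Qed.

Lemma left_continuous_denoised (markovX : Defs.markov X)
    (regX : right_continuous_in_probability X) (kerQ : denoising_kernel X Q)
    (psi : R -> R) f eta : continuous psi -> bounded_measurable f ->
  0 < eta -> eta <= 1 ->
  \int[P]_o psi (kernel_op (Q theta 1) f (Y theta o)) @[theta --> eta^'-] -->
  \int[P]_o psi (kernel_op (Q eta 1) f (Y eta o)).
Proof.
move=> cpsi bf eta0 eta1.
have [_ [b fb]] := bf.
have Mb theta x : `|kernel_op (Q theta 1) f x| <= b.
  have := @kernel_op_close _ _ _ _ _ (Q theta 1) f (fun=> 0) b x bf.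
  rewrite kernel_op_cst subr0; apply; first exact: bounded_measurable_cst.
  by move=> y; rewrite subr0.
have bM theta : bounded_measurable (kernel_op (Q theta 1) f).
  exact: bounded_measurable_kernel_op.
apply/cvgrPdist_le => e e0; have e20 : 0 < e / 2 by rewrite divr_gt0.
(* The bound [b] of [f] bounds its denoised versions at all times, so this [K] does not depend on
   [theta]. *)
have [K K0 HK] := Rintegral_modulus P b cpsi e20.
have K1 : 0 < K + 1 by rewrite ltr_wpDl.
near=> theta.
have theta0 : 0 <= theta by near: theta; exact: nbhs_left_ge.
have te : theta <= eta by near: theta; exact: nbhs_left_le.
have [w bw aw] : exists2 w, bounded_measurable w &
    \int[P]_o (kernel_op (Q eta 1) f (Y eta o) - w (Y theta o)) ^+ 2 <=
      (e / 2) / (K + 1).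
  near: theta; apply: left_approximable_bounded_measurable => //.
  by rewrite divr_gt0.
have D2 := le_trans (denoised_projection markovX kerQ theta0 te eta1 bf bw) aw.
have := HK (fun o => kernel_op (Q eta 1) f (Y eta o))
  (fun o => kernel_op (Q theta 1) f (Y theta o)) _ _ _ _.
move=> /(_ (bounded_measurable_RV _ (bM _)) (bounded_measurable_RV _ (bM _))).
move=> /(_ (fun o => Mb _ _) (fun o => Mb _ _)) /le_trans; apply.
rewrite [leRHS](splitr e) lerD2l.
apply: (@le_trans _ _ (K * ((e / 2) / (K + 1)))); first by rewrite ler_wpM2l.
by rewrite mulrA ler_pdivrMr// mulrC ler_pM2l//; lra.
Unshelve. all: by end_near.
Qed.

End LeftContinuity.

(** * Functions supported on a finite set *)

Section FiniteSupport.
Context (R : realType) (n : nat).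
Implicit Types (D : set (rn R n)) (f : rn R n -> R).

Lemma measurable_rn_set1 (x : rn R n) : measurable [set x].
Proof.
rewrite (_ : [set x] = \bigcap_(j in [set: 'I_n])
    (fun y : rn R n => (y : 'rV[R]_n) ord0 j) @^-1` [set (x : 'rV[R]_n) ord0 j]).
  apply: fin_bigcap_measurable => // j _; rewrite -[X in measurable X]setTI.
  exact: (measurable_coord ord0 j measurableT (measurable_set1 _)).
apply/seteqP; split=> [y ->|y H]//=.
by apply/rowP => j; exact: (H j I).
Qed.

(** All subsets of a finite set are Borel, so an arbitrary [f] is measurable on [D]. *)
Lemma bounded_measurable_finite_support D f : finite_set D ->
  bounded_measurable (f \_ D).
Proof.
move=> finD.
have countable_measurable_sub (A : set (rn R n)) : A `<=` D -> measurable A.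
  move=> AD; apply: countable_measurable; first exact: measurable_rn_set1.
  exact/finite_set_countable/(sub_finite_set AD).
have mD : measurable D by exact: countable_measurable_sub.
have mf : measurable_fun D f.
  by move=> _ B _; apply: countable_measurable_sub => x [].
split; first exact: (measurable_restrictT _ mD).1 mf.
have /finite_seqP[s sD] := finD.
exists (\sum_(y <- s) `|f y|) => x; rewrite patchE; case: ifPn => [xD|_].
  have xs : x \in s by move: xD; rewrite inE sD.
  by rewrite (big_rem x xs)/= lerDl sumr_ge0.
by rewrite normr0 sumr_ge0.
Qed.

End FiniteSupport.

(** * Measurability and nonnegativity of the entropy of a kernel *)

Section EntropyOfKernels.
Context d d' (T : measurableType d) (U : measurableType d') (R : realType).
Variables (Q : R.-pker T ~> U) (phi : R -> R).
Hypothesis cvphi : convex_function (`[0, +oo[%classic : set R) phi.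
Hypothesis cphi : {within `[0, +oo[%classic, continuous phi}.
Variable g : U -> R.
Hypotheses (bg : bounded_measurable g) (g0 : forall x, 0 <= g x).
Local Notation psi := (fun x : R => phi (Num.max x 0)).

Lemma phi_ent_kernelE x : phi_ent phi (Q x) g =
  kernel_op Q (fun y => psi (g y)) x - psi (kernel_op Q g x).
Proof.
rewrite /phi_ent; congr (_ - _).
  by apply: eq_Rintegral => y _; rewrite max_l.
by rewrite max_l//; exact: kernel_op_ge0.
Qed.

Lemma bounded_measurable_phi_ent_kernel :
  bounded_measurable (fun x => phi_ent phi (Q x) g).
Proof.
have cpsi := continuous_comp_max0 cphi.
rewrite [X in bounded_measurable X](_ : _ = fun x =>
  kernel_op Q (fun y => psi (g y)) x - psi (kernel_op Q g x)).
  apply: bounded_measurableB.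
    apply: bounded_measurable_kernel_op.
    exact: (bounded_measurable_comp_continuous cpsi).
  apply: (bounded_measurable_comp_continuous cpsi).
  exact: bounded_measurable_kernel_op.
by apply/funext => x; exact: phi_ent_kernelE.
Qed.

Lemma phi_ent_kernel_ge0 x : 0 <= phi_ent phi (Q x) g.
Proof.
rewrite /phi_ent subr_ge0; have [p <-] := kernel_probability Q x.
exact: jensen.
Qed.

End EntropyOfKernels.

(** * Evolution of the mean entropy *)

Section EntropyFlow.
Context d (Omega : measurableType d) (R : realType) (n : nat).
Variables (P : probability Omega R) (X : R -> {RV P >-> rn R n}).
Variables (mu : probability (rn R n) R) (Q : R -> R -> R.-pker rn R n ~> rn R n).
Variables (S : R -> set (rn R n)) (phi C : R -> R) (D : set (rn R n)).
Hypotheses (finD : finite_set D) (noisX : noising_process X mu).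
Hypotheses (kerQ : denoising_kernel X Q) (stS : state_space X S).
Hypothesis cvphi : convex_function (`[0, +oo[%classic : set R) phi.
Hypothesis cphi : {within `[0, +oo[%classic, continuous phi}.
Hypothesis C_ge0 : forall eta, 0 <= eta -> eta <= 1 -> 0 <= C eta.
Hypothesis stable : entropically_stable D Q S phi C.
Hypothesis dominated : dominated_entropy_quotients X D Q S phi.
Variable f : rn R n -> R.
Hypothesis f_ge0 : nonneg_on D f.

Local Notation Y := (denoising X).
Local Notation psi := (fun x : R => phi (Num.max x 0)).
Local Notation F := (f \_ D).
Local Notation M := (denoised D Q f).

Definition mean_entropy (theta : R) : R :=
  \int[denoising_law X theta]_x phi_ent phi (Q theta 1 x) F.

Let bF : bounded_measurable F. Proof. exact: bounded_measurable_finite_support. Qed.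

Let F0 x : 0 <= F x.
Proof. by rewrite patchE; case: ifPn => // /[!inE]; exact: f_ge0. Qed.

Let bM theta : bounded_measurable (M theta).
Proof. exact: bounded_measurable_kernel_op. Qed.

Let M0 theta x : 0 <= M theta x.
Proof. exact: kernel_op_ge0. Qed.

Let cpsi : continuous psi. Proof. exact: continuous_comp_max0. Qed.

Let bpsi d' (T : measurableType d') (g : T -> R) : bounded_measurable g ->
  bounded_measurable (fun x => psi (g x)).
Proof. exact: (bounded_measurable_comp_continuous cpsi). Qed.

Let Rintegral_kernel1 eta theta (g : rn R n -> R) : 0 <= eta -> eta <= theta ->
  theta <= 1 -> bounded_measurable g ->
  \int[P]_o kernel_op (Q eta theta) g (Y eta o) = \int[P]_o g (Y theta o).
Proof.
move=> eta0 et t1 bg.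
have := Rintegral_kernel kerQ eta0 et t1 (bounded_measurable_cst (rn R n) 1) bg.
under eq_Rintegral do rewrite mul1r.
by under [X in _ = X -> _]eq_Rintegral do rewrite mul1r.
Qed.

(** A general [g] serves twice: [F] at time 1 gives the mean entropy itself, [M theta] at time
    [theta] its increments. *)
Lemma mean_phi_ent_kernel eta theta (g : rn R n -> R) : 0 <= eta ->
  eta <= theta -> theta <= 1 -> bounded_measurable g -> (forall x, 0 <= g x) ->
  \int[denoising_law X eta]_x phi_ent phi (Q eta theta x) g =
  \int[P]_o psi (g (Y theta o)) -
  \int[P]_o psi (kernel_op (Q eta theta) g (Y eta o)).
Proof.
move=> eta0 et t1 bg g0.
rewrite Rintegral_denoising_law; last exact: bounded_measurable_phi_ent_kernel.
under eq_Rintegral do rewrite phi_ent_kernelE//.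
rewrite bRintegralB; last 2 first.
- exact/bounded_measurable_RV/bounded_measurable_kernel_op/bpsi.
- exact/bpsi/bounded_measurable_RV/bounded_measurable_kernel_op.
by rewrite Rintegral_kernel1//; exact: bpsi.
Qed.

Lemma mean_entropyE theta : 0 <= theta -> theta <= 1 ->
  mean_entropy theta =
  \int[P]_o psi (F (Y 1 o)) - \int[P]_o psi (M theta (Y theta o)).
Proof. by move=> t0 t1; rewrite /mean_entropy mean_phi_ent_kernel. Qed.

Lemma mean_entropy_ge0 theta : 0 <= mean_entropy theta.
Proof. by apply: Rintegral_ge0 => x _; exact: phi_ent_kernel_ge0. Qed.

(** Chapman-Kolmogorov in an almost sure form. The difference of the two functions is itself a
    function of [Y eta]; tested against it, both have the same integral as [F (Y 1)]. *)
Lemma kernel_op_denoised_sqr_dist eta theta : 0 <= eta -> eta <= theta -> theta <= 1 ->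
  \int[P]_o (kernel_op (Q eta theta) (M theta) (Y eta o) - M eta (Y eta o)) ^+ 2
  = 0.
Proof.
move=> eta0 et t1; have eta1 := le_trans et t1.
set a := kernel_op (Q eta theta) (M theta).
have ba : bounded_measurable a by exact: bounded_measurable_kernel_op.
have bk : bounded_measurable (fun x => a x - M eta x) by exact: bounded_measurableB.
have bkY := bounded_measurable_RV (Y eta) bk.
have baY := bounded_measurable_RV (Y eta) ba.
have bMY := bounded_measurable_RV (Y eta) (bM eta).
have -> : \int[P]_o (a (Y eta o) - M eta (Y eta o)) ^+ 2 =
    \int[P]_o ((a (Y eta o) - M eta (Y eta o)) * a (Y eta o) -
               (a (Y eta o) - M eta (Y eta o)) * M eta (Y eta o)).
  by apply: eq_Rintegral => o _; ring.
rewrite bRintegralB; [|exact: bounded_measurableM..].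
have := Rintegral_kernel kerQ eta0 et t1 bk (bM theta).
have := Rintegral_tower (noising_markov noisX) kerQ eta0 et t1 bk bF.
have := Rintegral_tower (noising_markov noisX) kerQ eta0 (lexx _) eta1 bk bF.
by rewrite /= -/(M theta) -/(M eta) -/a => <- <- ->; rewrite subrr.
Qed.

Lemma mean_entropy_increment eta theta : 0 <= eta -> eta <= theta -> theta <= 1 ->
  \int[denoising_law X eta]_x phi_ent phi (Q eta theta x) (M theta) =
  mean_entropy eta - mean_entropy theta.
Proof.
move=> eta0 et t1.
have ba := bounded_measurable_kernel_op (Q eta theta) (bM theta).
rewrite !mean_entropyE ?(le_trans et)// ?(le_trans eta0)// mean_phi_ent_kernel//.
suff -> : \int[P]_o psi (kernel_op (Q eta theta) (M theta) (Y eta o)) =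
  \int[P]_o psi (M eta (Y eta o)) by ring.
(* With L^2 distance 0, the modulus bounds the difference of the [psi]-means by every positive
   [e]. *)
apply/eqP; rewrite -subr_eq0 -normr_le0; apply/ler_addgt0Pr => e e0.
have [_ [b1 Hb1]] := ba; have [_ [b2 Hb2]] := bM eta.
have [K _ HK] := Rintegral_modulus P (Num.max b1 b2) cpsi e0.
rewrite add0r.
have := HK (fun o => kernel_op (Q eta theta) (M theta) (Y eta o))
  (fun o => M eta (Y eta o)) (bounded_measurable_RV _ ba)
  (bounded_measurable_RV _ (bM eta)).
rewrite kernel_op_denoised_sqr_dist// mulr0 addr0; apply=> o.
  by rewrite le_max Hb1.
by rewrite le_max Hb2 orbT.
Qed.

Lemma Rintegral_state_space s (g : rn R n -> R) : 0 <= s -> s <= 1 ->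
  bounded_measurable g ->
  \int[denoising_law X s]_(x in S s) g x = \int[denoising_law X s]_x g x.
Proof.
move=> s0 s1 bg; have [mS S1] := stS s0 s1.
rewrite /Rintegral; congr fine.
rewrite [RHS](negligible_integral (N := ~` S s))//.
- by rewrite setTD setCK.
- exact: measurableC.
- exact: bounded_measurable_integrable.
- by rewrite [LHS]probability_setC// [X in (1 - X)%E]S1 subee.
Qed.

(** The right limit is tested along sequences, for dominated convergence. By Jensen the quotients
    are nonnegative, so the one-sided bound [g] dominates their absolute values. *)
Lemma mean_entropy_quotient_cvg s : 0 <= s -> s < 1 ->
  exists2 L, L <= C s / (1 - s) * mean_entropy s &
    (t - s)^-1 * (mean_entropy s - mean_entropy t) @[t --> s^'+] --> L.
Proof.
move=> s0 s1; have [mS _] := stS s0 (ltW s1).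
pose q t x := (t - s)^-1 * phi_ent phi (Q s t x) (M t).
pose nu : probability (rn R n) R := denoising_law X s.
have bq t : bounded_measurable (q t).
  by apply: bounded_measurableZ; exact: bounded_measurable_phi_ent_kernel.
have [l Hl] : exists l : rn R n -> R, forall x, S s x ->
    q t x @[t --> s^'+] --> l x /\
    l x <= C s / (1 - s) * phi_ent phi (Q s 1 x) F.
  have : forall x, exists lx : R, S s x -> q t x @[t --> s^'+] --> lx /\
      lx <= C s / (1 - s) * phi_ent phi (Q s 1 x) F.
    move=> x; have [Sx|nSx] := pselect (S s x); last by exists 0.
    by have [lx Hlx] := stable s0 s1 Sx f_ge0; exists lx.
  by move=> /choice[l Hl]; exists l.
have [g ig gdom] := dominated s0 s1 f_ge0.
have bent : bounded_measurable (fun x => phi_ent phi (Q s 1 x) F).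
  exact: bounded_measurable_phi_ent_kernel.
have qseq (t_ : nat -> R) : (forall k, s < t_ k) /\ t_ k @[k --> \oo] --> s ->
    [/\ nu.-integrable (S s) (EFin \o l) &
        \int[nu]_(x in S s) q (t_ k) x @[k --> \oo] --> \int[nu]_(x in S s) l x].
  move=> [st cvt].
  have [N _ HN] : \forall k \near \oo, forall x, S s x -> q (t_ k) x <= g x.
    have [r r0 Hr] := near_at_rightP gdom.
    have /cvgrPdist_lt/(_ _ r0) := cvt; apply: filterS => k sk x Sx.
    apply: Hr => //.
    by move: sk; rewrite distrC gtr0_norm ?subr_gt0//; lra.
  have qpos t x : s < t -> 0 <= q t x.
    move=> st'; rewrite /q mulr_ge0//; last exact: phi_ent_kernel_ge0.
    by rewrite invr_ge0 subr_ge0 ltW.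
  (* The domination by [g] holds only from the index [N] on, hence the shifted sequence. *)
  have mq k : measurable_fun (S s) (EFin \o q (t_ (k + N)%N)).
    by apply/measurable_EFinP/measurable_funTS; case: (bq (t_ (k + N)%N)).
  have cvq x : S s x -> (EFin \o q (t_ (k + N)%N)) x @[k --> \oo] --> (EFin \o l) x.
    move=> Sx; apply: cvg_EFin; first exact: nearW.
    have [/cvg_at_rightP/(_ t_) H _] := Hl _ Sx.
    have := H (conj st cvt).
    by rewrite -(cvg_shiftn N (fun k => q (t_ k) x)).
  have dom k x : S s x -> (`|(EFin \o q (t_ (k + N)%N)) x| <= (EFin \o g) x)%E.
    move=> Sx; rewrite lee_fin ger0_norm; last exact: qpos.
    by apply: HN => //=; rewrite leq_addl.
  have [il _ cvI] := dominated_convergence mS mq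
    (emeasurable_fun_cvg _ _ mq cvq) (aeW nu cvq)
    (integrableS measurableT mS (@subsetT _ _) ig)
    (aeW nu (fun x k => dom k x)).
  split=> //; rewrite -(cvg_shiftn N (fun k => \int[nu]_(x in S s) q (t_ k) x)).
  by apply: fine_cvg; rewrite fineK//; exact: integrable_fin_num il.
pose L := \int[nu]_(x in S s) l x.
have cvL : \int[nu]_(x in S s) q t x @[t --> s^'+] --> L.
  by apply/cvg_at_rightP => t_ /qseq[].
exists L.
  (* Any sequence decreasing to [s] would do: it only serves to obtain the integrability of [l]. *)
  have [|il _] := qseq (fun k => s + k.+1%:R^-1).
    split=> [k|]; first by rewrite ltrDl.
    rewrite -[X in _ --> X]addr0; apply: cvgD; first exact: cvg_cst.
    exact: cvg_harmonic.
  have bCent := bounded_measurableZ (C s / (1 - s)) bent.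
  have -> : C s / (1 - s) * mean_entropy s =
      \int[nu]_(x in S s) (C s / (1 - s) * phi_ent phi (Q s 1 x) F).
    rewrite Rintegral_state_space//; last exact: ltW.
    by rewrite bRintegralZ.
  apply: le_Rintegral => //; first exact: bounded_measurable_integrable.
  by move=> x Sx; have [] := Hl x Sx.
move: cvL; apply: cvg_trans; apply: near_eq_cvg; near=> t.
have t1 : t < 1 by near: t; exact: nbhs_right_lt.
have st : s < t by near: t; exact: nbhs_right_gt.
rewrite Rintegral_state_space//; last exact: ltW.
rewrite bRintegralZ ?mean_entropy_increment//; try exact: ltW.
exact: bounded_measurable_phi_ent_kernel.
Unshelve. all: by end_near.
Qed.

Lemma mean_entropy_dini s k : 0 <= s -> s < 1 -> C s / (1 - s) < k ->
  \forall t \near s^'+, mean_entropy s - mean_entropy t <=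
    k * mean_entropy s * (t - s).
Proof.
(* If the mean entropy vanishes at [s], the gap between [C s / (1 - s)] and [k] yields no strict
   inequality after multiplication, but nonnegativity at [t] already gives the bound. *)
move=> s0 s1 ck; have [u0|u_neq0] := eqVneq (mean_entropy s) 0.
  apply: nearW => t; rewrite u0 mulr0 mul0r sub0r oppr_le0.
  exact: mean_entropy_ge0.
have u_gt0 : 0 < mean_entropy s.
  by rewrite lt_neqAle eq_sym u_neq0 mean_entropy_ge0.
have [L Lle cvL] := mean_entropy_quotient_cvg s0 s1.
have Lk : L < k * mean_entropy s by apply: le_lt_trans Lle _; rewrite ltr_pM2r.
near=> t.
have st : s < t by near: t; exact: nbhs_right_gt.
have : (t - s)^-1 * (mean_entropy s - mean_entropy t) <= k * mean_entropy s.
  by near: t; exact: cvgr_le cvL _ Lk.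
by rewrite mulrC ler_pdivrMr// subr_gt0.
Unshelve. all: by end_near.
Qed.

Lemma mean_entropy_left_continuous s : 0 < s -> s <= 1 ->
  mean_entropy t @[t --> s^'-] --> mean_entropy s.
Proof.
move=> s0 s1; rewrite mean_entropyE ?(ltW s0)//.
have H : \int[P]_o psi (F (Y 1 o)) - \int[P]_o psi (M t (Y t o)) @[t --> s^'-] -->
    \int[P]_o psi (F (Y 1 o)) - \int[P]_o psi (M s (Y s o)).
  apply: cvgB; first exact: cvg_cst.
  exact: (left_continuous_denoised (noising_markov noisX)
    (noising_regular noisX) kerQ cpsi bF s0 s1).
move: H; apply: cvg_trans; apply: near_eq_cvg; near=> t.
rewrite mean_entropyE//; first by near: t; exact: nbhs_left_ge.
by rewrite (le_trans _ s1)//; near: t; exact: nbhs_left_le.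
Unshelve. all: by end_near.
Qed.

Lemma Rintegral_denoising0 (k : rn R n -> R) : bounded_measurable k ->
  \int[P]_o k (Y 0 o) = k (0 : 'rV[R]_n).
Proof.
move=> bk; rewrite -[RHS](bRintegral_cst P) /Rintegral; congr fine.
apply: ae_eq_integral => //.
- by apply/measurable_EFinP; case: (bounded_measurable_RV (Y 0) bk).
- have := noising_end noisX; apply: filterS => o X0 _.
  by rewrite /denoising subr0 X0.
Qed.

Lemma Rintegral_denoising1 (k : rn R n -> R) : bounded_measurable k ->
  \int[P]_o k (Y 1 o) = \int[mu]_x k x.
Proof.
move=> bk; rewrite -Rintegral_denoising_law// /Rintegral; congr fine.
apply: eq_measure_integral => A mA _.
by have := noising_start noisX mA; rewrite /denoising_law /denoising subrr.
Qed.

Lemma mean_entropy0 : mean_entropy 0 = phi_ent phi mu F.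
Proof.
rewrite mean_entropyE//.
have -> : \int[P]_o psi (F (Y 1 o)) = \int[mu]_x psi (F x).
  exact: (Rintegral_denoising1 (bpsi bF)).
have -> : \int[P]_o psi (M 0 (Y 0 o)) = psi (M 0 (0 : 'rV[R]_n)).
  exact: (Rintegral_denoising0 (bpsi (bM 0))).
(* The kernel is meaningful at the single state 0 because [Y 0] equals 0 almost surely: averaging
   [M 0] over it is evaluating at 0. *)
have <- : \int[mu]_x F x = M 0 (0 : 'rV[R]_n).
  rewrite -Rintegral_denoising1// -Rintegral_denoising0//.
  by rewrite -(Rintegral_kernel1 (lexx _) ler01 (lexx _) bF).
rewrite /phi_ent max_l; last exact: Rintegral_ge0.
by congr (_ - _); apply: eq_Rintegral => x _; rewrite max_l.
Qed.

End EntropyFlow.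

Theorem theorem3p15 (R : realType) (n : nat)
  (D : set (rn R n)) (mu : probability (rn R n) R)
  (d : measure_display) (Omega : measurableType d) (P : probability Omega R)
  (X : R -> {RV P >-> rn R n})
  (Q : R -> R -> R.-pker rn R n ~> rn R n) (S : R -> set (rn R n))
  (phi C : R -> R)
  (finD : finite_set D) (muD : mu D = 1%E)
  (noisX : noising_process X mu)
  (kerQ : denoising_kernel X Q) (stS : state_space X S)
  (convex_phi : convex_function (`[0, +oo[%classic : set R) phi)
  (cont_phi : {within `[0, +oo[%classic, continuous phi})
  (C_ge0 : forall eta, 0 <= eta -> eta <= 1 -> 0 <= C eta)
  (stable : entropically_stable D Q S phi C)
  (dominated : dominated_entropy_quotients X D Q S phi)
  (theta : R) (theta_ge0 : 0 <= theta) (theta_le1 : theta <= 1)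
  (integrableC : lebesgue_measure.-integrable `[0, theta]
     (EFin \o (fun eta => C eta / (1 - eta)))) :
  approx_entropy_conservation X D Q phi mu
    (expR (\int[lebesgue_measure]_(eta in `[0, theta]) (C eta / (1 - eta))))
    theta.
Proof.
move=> f f_ge0.
have subT s : s <= theta -> s <= 1 by move/le_trans; apply.
rewrite -(mean_entropy0 finD noisX kerQ cont_phi f_ge0).
apply: gronwall_dini => //.
(* For [theta = 1] the endpoint [s = 1] is included; there the quotient is 0 by the convention on
   division. *)
- move=> s /andP[s0 st]; rewrite divr_ge0 ?C_ge0 ?subT//.
  by rewrite subr_ge0 subT.
- by move=> s _; exact: mean_entropy_ge0.
- move=> s k s0 st; apply: (mean_entropy_dini finD noisX kerQ stS) => //.
  exact: lt_le_trans st theta_le1.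
- move=> s s0 st; apply: (mean_entropy_left_continuous finD noisX kerQ) => //.
  exact: subT.
Qed.
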